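(* Let $n\ge 2$. The number of left cosets of $\mathcal{N}(\hat{\mathbb{Z}})$ in $\mathrm{Aut}(\mathrm{Aut}^\infty(\sigma_n))$ is countable.
   Context: $X_n=\{0,\dots,n-1\}^{\mathbb{Z}}$ with the product topology, $\sigma_n$ is the shift $(\sigma_n(x))_i=x_{i+1}$. $\mathrm{Aut}(\sigma_n^k)$ is the group of homeomorphisms of $X_n$ commuting with $\sigma_n^k$, and $\mathrm{Aut}^\infty(\sigma_n)=\bigcup_{k\ge1}\mathrm{Aut}(\sigma_n^k)$. $\mathrm{Aut}(\mathrm{Aut}^\infty(\sigma_n))$ is the group of automorphisms of the group $\mathrm{Aut}^\infty(\sigma_n)$. $\hat{\mathbb{Z}}=\varprojlim\mathbb{Z}/m\mathbb{Z}$ is the group of sequences $(a_m)_{m\in\mathbb{N}}\in\prod_m\mathbb{Z}/m\mathbb{Z}$ with $a_{km}\equiv a_m\bmod m$ for all $m,k$. The homomorphism $\mathcal{N}\colon\hat{\mathbb{Z}}\to\mathrm{Aut}(\mathrm{Aut}^\infty(\sigma_n))$ is defined by $\mathcal{N}((a_m)_m)(\varphi)=\sigma_n^{-a_k}\circ\varphi\circ\sigma_n^{a_k}$ for $\varphi\in\mathrm{Aut}(\sigma_n^k)$ (this is independent of the choices of $k$ and of the representative of $a_k$). *)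

(* Defs.v *)
From HB Require Import structures.
From mathcomp Require Import all_boot all_order all_algebra all_fingroup.
From mathcomp Require Import boolp classical_sets functions cardinality.
From mathcomp Require Import topology.

Set Implicit Arguments.
Unset Strict Implicit.
Unset Printing Implicit Defensive.
Import Order.TTheory GRing.Theory.
Local Open Scope classical_set_scope.
Local Open Scope group_scope.

(* In the group of bijections of [T], [f * g] is the map [f \o g]; groups of
   homeomorphisms and of group automorphisms inherit this law. *)

Record bijection (T : Type) := Bijection {
  bij_fun :> T -> T;
  bij_inv : T -> T;
  bij_funK : cancel bij_fun bij_inv;
  bij_invK : cancel bij_inv bij_fun
}.

HB.instance Definition _ (T : Type) := gen_eqMixin (bijection T).
HB.instance Definition _ (T : Type) := gen_choiceMixin (bijection T).

Section BijectionGroup.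
Variable T : Type.
Implicit Types f g h : bijection T.

Lemma bijectionP f g : (forall x, f x = g x) -> f = g.
Proof.
case: f g => [f f' fK f'K] [g g' gK g'K] /= fg.
have {}fg : f = g by apply: funext.
subst g.
have f'g' : f' = g' by apply: funext => x; rewrite -{1}(g'K x) fK.
by subst g'; congr Bijection; apply: Prop_irrelevance.
Qed.

Definition bij_one : bijection T :=
  @Bijection T id id (fun=> erefl) (fun=> erefl).

Definition bij_opp f : bijection T := Bijection (@bij_invK T f) (@bij_funK T f).

Definition bij_mul f g : bijection T :=
  Bijection (can_comp (@bij_funK T f) (@bij_funK T g))
            (can_comp (@bij_invK T g) (@bij_invK T f)).

Lemma bij_mulA : associative bij_mul.
Proof. by move=> f g h; apply: bijectionP. Qed.
Lemma bij_mul1 : left_id bij_one bij_mul.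
Proof. by move=> f; apply: bijectionP. Qed.
Lemma bij_mulr1 : right_id bij_one bij_mul.
Proof. by move=> f; apply: bijectionP. Qed.
Lemma bij_mulV : left_inverse bij_one bij_opp bij_mul.
Proof. by move=> f; apply: bijectionP => x /=; rewrite bij_funK. Qed.
Lemma bij_mulrV : right_inverse bij_one bij_opp bij_mul.
Proof. by move=> f; apply: bijectionP => x /=; rewrite bij_invK. Qed.

HB.instance Definition _ := isGroup.Build (bijection T)
  bij_mulA bij_mul1 bij_mulr1 bij_mulV bij_mulrV.

End BijectionGroup.

Definition is_homeo (T : topologicalType) (f : bijection T) : bool :=
  `[< continuous (f : T -> T) /\ continuous (bij_inv f : T -> T) >].

Record homeo (T : topologicalType) := Homeo {
  homeo_bij :> bijection T;
  _ : is_homeo homeo_bij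
}.

HB.instance Definition _ (T : topologicalType) := [isSub for @homeo_bij T].
HB.instance Definition _ (T : topologicalType) := [Choice of homeo T by <:].

Lemma is_homeo_closed (T : topologicalType) : group_closed (@is_homeo T).
Proof.
split=> [|f g /asboolP[cf cf'] /asboolP[cg cg']]; apply/asboolP.
  by split=> x; exact: cvg_id.
by split=> x; [apply: continuous_comp (cg' x) (cf _)
              | apply: continuous_comp (cf' x) (cg _)].
Qed.

HB.instance Definition _ (T : topologicalType) :=
  SubChoice_isSubGroup.Build _ _ (homeo T) (@is_homeo_closed T).

Definition is_groupaut (G : groupType) (f : bijection G) : bool :=
  `[< {morph f : x y / x * y} >].

Record groupaut (G : groupType) := GroupAut {
  groupaut_bij :> bijection G;
  _ : is_groupaut groupaut_bij
}.

HB.instance Definition _ (G : groupType) := [isSub for @groupaut_bij G].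
HB.instance Definition _ (G : groupType) := [Choice of groupaut G by <:].

Lemma is_groupaut_closed (G : groupType) : group_closed (@is_groupaut G).
Proof.
split=> [|f g /asboolP fM /asboolP gM]; apply/asboolP => // x y /=.
rewrite -fM; congr (f _).
by apply: (can_inj (@bij_funK _ g)); rewrite gM !bij_invK.
Qed.

HB.instance Definition _ (G : groupType) :=
  SubChoice_isSubGroup.Build _ _ (groupaut G) (@is_groupaut_closed G).

(* The library's [lcosets] is limited to finite groups. *)
Definition left_cosets (G : groupType) (H : set G) : set (set G) :=
  [set [set x * h | h in H] | x in [set: G]].

Definition fullshift (n : nat) : topologicalType :=
  {ptws int -> discrete_topology 'I_n}.

Section Shift.
Variable n : nat.

Definition shift_fun (x : fullshift n) : fullshift n := fun i => x (i + 1)%R.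
Definition shift_inv (x : fullshift n) : fullshift n := fun i => x (i - 1)%R.

Lemma shift_funK : cancel shift_fun shift_inv.
Proof. by move=> x; apply: funext => i; rewrite /shift_inv /shift_fun subrK. Qed.
Lemma shift_invK : cancel shift_inv shift_fun.
Proof. by move=> x; apply: funext => i; rewrite /shift_inv /shift_fun addrK. Qed.

Lemma reindex_continuous (r : int -> int) :
  continuous ((fun x => x \o r) : fullshift n -> fullshift n).
Proof.
move=> x; apply/cvg_sup; first exact/fmap_filter/(nbhs_filter x).
move=> i U [V [[W oW <-] Wx VU]].
have nW : nbhs (x (r i) : discrete_topology 'I_n) W by exact: open_nbhs_nbhs.
have := @proj_continuous int (fun=> discrete_topology 'I_n) (r i) x W nW.
by apply: (@filterS _ _ (nbhs_filter x)) => y Wy; apply: VU.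
Qed.

Lemma shift_is_homeo : is_homeo (Bijection shift_funK shift_invK).
Proof. by apply/asboolP; split; apply: reindex_continuous. Qed.

Definition shift : homeo (fullshift n) := Homeo shift_is_homeo.

(* [aut_shift k] is $\mathrm{Aut}(\sigma_n^k)$ and [autinf] is $\mathrm{Aut}^\infty(\sigma_n)$. *)
Definition aut_shift (k : nat) : set (homeo (fullshift n)) :=
  [set f | commute f (shift ^+ k)].

Definition autinf_set : set (homeo (fullshift n)) :=
  \bigcup_(k in [set k | (0 < k)%N]) aut_shift k.

Record autinf := AutInf {
  autinf_homeo :> homeo (fullshift n);
  _ : autinf_homeo \in autinf_set
}.

HB.instance Definition _ := [isSub for autinf_homeo].
HB.instance Definition _ := [Choice of autinf by <:].

Lemma aut_shift_mull k l f : aut_shift k f -> aut_shift (k * l) f.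
Proof. by move=> fk; rewrite /aut_shift /= expgnA; apply: commuteX. Qed.

Lemma autinf_set_closed : group_closed (fun f => f \in autinf_set).
Proof.
split=> [|f g /set_mem[k /= k0 fk] /set_mem[l /= l0 gl]]; apply/mem_set.
  by exists 1%N => //; apply/commute_sym/commute1.
exists (k * l)%N; first by rewrite /= muln_gt0 k0.
apply/commute_sym/commuteM; first by apply/commute_sym/aut_shift_mull.
by apply/commuteV/commute_sym; rewrite mulnC; apply: aut_shift_mull.
Qed.

HB.instance Definition _ :=
  SubChoice_isSubGroup.Build _ _ autinf autinf_set_closed.

Lemma shift_autinf : shift \in autinf_set.
Proof. by apply/mem_set; exists 1%N. Qed.

Definition sigma : autinf := AutInf shift_autinf.

End Shift.

(* $\hat{\mathbb{Z}}$: the component at index [m] is the residue modulo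
   [m.+1]; the library makes ['I_m.+1] the additive group Z/(m+1)Z. *)
Definition zhat_coherent (a : forall m, 'I_m.+1) : Prop :=
  forall m k : nat, (a (k.+1 * m.+1).-1 = a m %[mod m.+1])%N.

Record zhat := Zhat {
  zhat_fun :> forall m, 'I_m.+1;
  zhatP : zhat_coherent zhat_fun
}.

HB.instance Definition _ := gen_eqMixin zhat.
HB.instance Definition _ := gen_choiceMixin zhat.

Lemma zhat_eqP (a b : zhat) : (forall m, a m = b m) -> a = b.
Proof.
case: a b => [a aP] [b bP] /= ab.
have {}ab : a = b by apply: functional_extensionality_dep.
by subst b; congr Zhat; apply: Prop_irrelevance.
Qed.

Lemma dvd_index m k : (m.+1 %| ((k.+1 * m.+1).-1).+1)%N.
Proof. by rewrite prednK ?muln_gt0 // dvdn_mull. Qed.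

Lemma zhat0_coherent : zhat_coherent (fun m => 0%R : 'I_m.+1).
Proof. by []. Qed.

Lemma zhatD_coherent (a b : zhat) : zhat_coherent (fun m => (a m + b m)%R).
Proof.
move=> m k /=; rewrite modn_dvdm ?dvd_index // modn_mod.
by rewrite -modnDm !zhatP modnDm.
Qed.

Lemma zhatN_coherent (a : zhat) : zhat_coherent (fun m => (- a m)%R).
Proof.
move=> m k /=; rewrite modn_dvdm ?dvd_index // modn_mod.
apply/eqP; rewrite -(eqn_modDr (a m)) subnK ?modnn; last exact/ltnW/ltn_ord.
rewrite -modnDmr -(zhatP a m k) modnDmr subnK; last exact/ltnW/ltn_ord.
exact: dvd_index.
Qed.

Definition zhat0 : zhat := Zhat zhat0_coherent.
Definition zhatD (a b : zhat) : zhat := Zhat (zhatD_coherent a b).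
Definition zhatN (a : zhat) : zhat := Zhat (zhatN_coherent a).

Lemma zhat_addA : associative zhatD.
Proof. by move=> a b c; apply: zhat_eqP => m; apply: addrA. Qed.
Lemma zhat_addC : commutative zhatD.
Proof. by move=> a b; apply: zhat_eqP => m; apply: addrC. Qed.
Lemma zhat_add0 : left_id zhat0 zhatD.
Proof. by move=> a; apply: zhat_eqP => m; apply: add0r. Qed.
Lemma zhat_addN : left_inverse zhat0 zhatN zhatD.
Proof. by move=> a; apply: zhat_eqP => m; apply: addNr. Qed.

HB.instance Definition _ := GRing.isZmodule.Build zhat
  zhat_addA zhat_addC zhat_add0 zhat_addN.

(* [residue a k] is the representative of $a_k$ in $\{0, \dots, k-1\}$,
   for [k > 0]. *)
Definition residue (a : zhat) (k : nat) : nat := a k.-1.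

Lemma residue_dvd (a : zhat) (k l : nat) :
  (0 < l)%N -> (k %| l)%N -> (residue a l = residue a k %[mod k])%N.
Proof.
move=> l0 /dvdnP[d dE]; subst l; move: l0; rewrite muln_gt0 => /andP[d0 k0].
by case: d d0 k k0 => // d _ [|k] // _; apply: zhatP.
Qed.

Lemma residueD (a b : zhat) (k : nat) : (0 < k)%N ->
  (residue (a + b)%R k = residue a k + residue b k %[mod k])%N.
Proof. by case: k => // k _; rewrite /residue /= modn_mod. Qed.

Section Twist.
Variable n : nat.
Implicit Types (a b : zhat) (f g : autinf n).

Lemma period_exists f : exists k, (0 < k)%N /\ aut_shift k f.
Proof. by case: f => f /= /set_mem[k k0 fk]; exists k. Qed.

Definition period f : nat := projT1 (cid (period_exists f)).

Lemma period_gt0 f : (0 < period f)%N.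
Proof. by rewrite /period; case: cid => k []. Qed.

Lemma period_aut f : aut_shift (period f) f.
Proof. by rewrite /period; case: cid => k []. Qed.

(* As [x ^ y] is [y^-1 * (x * y)], this is
   $\sigma_n^{-a_k}\circ\varphi\circ\sigma_n^{a_k}$ for one [k] such that
   $\varphi\in\mathrm{Aut}(\sigma_n^k)$; [twistE] shows that neither the choice of
   [k] nor that of the representative of $a_k$ matters. *)
Definition twist a f : autinf n := f ^ (sigma n ^+ residue a (period f)).

Lemma val_sigmaX k : val (sigma n ^+ k) = shift n ^+ k.
Proof. by elim: k => // k IH; rewrite !expgS /= -IH. Qed.

Lemma aut_shiftE k f : aut_shift k f <-> commute f (sigma n ^+ k).
Proof.
rewrite /aut_shift /= /commute -val_sigmaX.
by split=> [fk|/(congr1 val)//]; apply: val_inj.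
Qed.

Lemma conj_sigma_mod k r s f : aut_shift k f -> (r = s %[mod k])%N ->
  f ^ (sigma n ^+ r) = f ^ (sigma n ^+ s).
Proof.
move=> /aut_shiftE fk rs.
suff H t : f ^ (sigma n ^+ t) = f ^ (sigma n ^+ (t %% k)%N) by rewrite H rs -H.
rewrite {1}(divn_eq t k) expgnDr conjgM mulnC expgnA; congr (_ ^ _).
by rewrite conjgE (commuteX _ fk) mulKg.
Qed.

Lemma twistE a f k r : (0 < k)%N -> aut_shift k f ->
  (r = residue a k %[mod k])%N -> twist a f = f ^ (sigma n ^+ r).
Proof.
move=> k0 fk rE; set l := (period f * k)%N.
have l0 : (0 < l)%N by rewrite muln_gt0 period_gt0.
rewrite (conj_sigma_mod fk rE) /twist.
rewrite -(conj_sigma_mod (period_aut f) (residue_dvd a l0 (dvdn_mulr _ _))) //.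
by rewrite -(conj_sigma_mod fk (residue_dvd a l0 (dvdn_mull _ _))).
Qed.

Lemma aut_shift_conj k r f : aut_shift k f -> aut_shift k (f ^ (sigma n ^+ r)).
Proof.
move=> /aut_shiftE fk; apply/aut_shiftE/commute_sym.
rewrite conjgE; have c : commute (sigma n ^+ k) (sigma n ^+ r).
  by rewrite /commute -!expgnDr addnC.
apply: commuteM; first exact: commuteV.
by apply: commuteM => //; apply: commute_sym.
Qed.

Lemma twist0 f : twist 0%R f = f.
Proof. by rewrite /twist conjg1. Qed.

Lemma twistD a b f : twist (a + b)%R f = twist a (twist b f).
Proof.
have k0 := period_gt0 f; have fk := period_aut f.
rewrite (twistE (a := a) k0 (aut_shift_conj _ fk) erefl) -conjgM -expgnDr.
by apply: (conj_sigma_mod fk); rewrite residueD // addnC.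
Qed.

Lemma twistM a : {morph twist a : f g / f * g}.
Proof.
move=> f g; set k := (period f * period g)%N.
have k0 : (0 < k)%N by rewrite muln_gt0 !period_gt0.
have fk : aut_shift k f by apply/aut_shift_mull/period_aut.
have gk : aut_shift k g by rewrite /k mulnC; apply/aut_shift_mull/period_aut.
have fgk : aut_shift k (f * g).
  apply/aut_shiftE/commute_sym/commuteM; apply/commute_sym; exact/aut_shiftE.
by rewrite (twistE k0 fk erefl) (twistE k0 gk erefl) (twistE k0 fgk erefl) conjMg.
Qed.

Lemma twistK a : cancel (twist a) (twist (- a)%R).
Proof. by move=> f; rewrite -twistD addNr twist0. Qed.

Lemma twistNK a : cancel (twist (- a)%R) (twist a).
Proof. by move=> f; rewrite -twistD subrr twist0. Qed.

Lemma twist_is_groupaut a : is_groupaut (Bijection (twistK a) (twistNK a)).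
Proof. by apply/asboolP; apply: twistM. Qed.

(* The homomorphism $\mathcal{N}$ *)
Definition twistaut a : groupaut (autinf n) := GroupAut (twist_is_groupaut a).

Lemma twistautD a b : twistaut (a + b)%R = twistaut a * twistaut b.
Proof. by apply/val_inj/bijectionP => f; apply: twistD. Qed.

End Twist.

(* Main.v *)
Require Import Defs.
From mathcomp Require Import all_boot all_order all_algebra all_fingroup.
From mathcomp Require Import all_solvable.
From mathcomp Require Import boolp classical_sets functions cardinality.
From mathcomp Require Import topology.
From mathcomp Require Import zify.

Set Implicit Arguments.
Unset Strict Implicit.
Unset Printing Implicit Defensive.
Import Order.TTheory GRing.Theory.
Local Open Scope classical_set_scope.
Local Open Scope group_scope.

(** Since the full shift is compact, an element of Aut^oo(sigma_n) is given by
    a period and a finite local rule, so this group is countable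
    ([autinf_code]).  Two automorphisms of it that agree on a given finite set
    of elements differ, on the right, by an automorphism fixing that set.  It is
    therefore enough to find finitely many elements such that every
    automorphism Phi fixing all of them is in the image of N
    ([rigid_twist]): the values on these elements then form a countable
    invariant of the left cosets.

    The elements are sigma, the permutations of the blocks of length 3 (the
    gates with 3 cells), and the three maps that move the cells of one residue
    class modulo 3 by one block and leave the others in place (the sliders).

    The first half of the argument shows that such a Phi comes from a
    permutation of periodic points.  As Phi fixes sigma, it preserves
    Aut(sigma^M), which acts on the n^M points of period M.  The gates with M
    cells form a copy of the symmetric group of this finite set, and composing
    Phi with the action gives an endomorphism of that symmetric group.  It is
    not trivial because Phi fixes the gates with 3 cells, so it is inner
    ([perm_endo_inner]), which provides a permutation p of the points of
    period M such that Phi(q) o p = p o q for every gate q with M cells.  This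
    equation extends to every g of small radius compared with M
    ([radius_implemented]): the map p^-1 o Phi(g)^-1 o p o g commutes with every
    local permutation E of two neighbouring cells for which both E and g E g^-1
    are already known to satisfy it, and a map that commutes with the
    permutations of two cells cannot change these cells.

    The second half determines p.  It commutes with the gates with 3 cells and
    with the sliders, since Phi fixes them.  A point is now seen as three
    tracks that can be slid against each other, with arbitrary permutations
    acting on the three letters found at chosen offsets.  A point with a
    single marked cell is characterized, up to translation, by the operations
    that fix it, so p translates it by some multiple 3 a of a cell
    ([p_marker]).  Any nonzero point whose support fits in a short part of the
    period can be brought to this form: the leftmost and the rightmost marks
    form the only pair at their distance, so an operation controlled by such
    a pair acts at one place only ([slides_sparse]).  Hence p is the translation
    by 3 a on all these sparse points.

    Sparse points become dense as M grows.  For f in Aut(sigma^(3m)) fixing the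
    zero point, the equation Phi(f) o p = p o f on sparse points of larger and
    larger periods says that Phi(f) is the conjugate of f by sigma^(3 a), where
    a matters modulo m only and can be chosen constant by the pigeonhole
    principle ([fix_zero_conjugated]).  The other elements of Aut(sigma^(3m))
    are products of such elements and of a gate with 3 cells
    ([conjugated_all]).  So on each Aut(sigma^k) the automorphism Phi is the
    conjugation by a power of sigma, the exponent is unique modulo k
    ([conj_sigma_inj]), and uniqueness makes these exponents coherent: they
    form an element of the profinite integers. *)

(** * Endomorphisms of finite symmetric groups *)

Lemma exists_fresh (T : finType) (s : seq T) :
  (size s < #|T|)%N -> exists x, x \notin s.
Proof.
move=> sT; apply/existsP; rewrite -negb_forall; apply/negP => /forallP sall.
suff: (#|T| <= size s)%N by rewrite leqNgt sT.
by rewrite -[#|T|](eq_card (A := mem s)) ?card_size // => x; rewrite (sall x).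
Qed.

Lemma central_perm1 (T : finType) (x : {perm T}) :
  (2 < #|T|)%N -> (forall y, x * y = y * x) -> x = 1.
Proof.
move=> T2 xC; apply/permP => a; rewrite perm1.
have [//|xa] := eqVneq (x a) a.
have [c] := @exists_fresh T [:: a; x a] T2; rewrite !inE negb_or => /andP[ca cx].
have /permP/(_ a) := xC (tperm (x a) c).
rewrite !permM tpermL tpermD // 1?eq_sym // => E; by rewrite E eqxx in cx.
Qed.

(** The kernel meets the simple alternating group trivially, as squares are
    even, and a normal subgroup meeting it trivially is central, since all
    commutators are even. *)
Lemma perm_endo_inj (T : finType) (th : {perm T} -> {perm T}) :
  (4 < #|T|)%N -> {morph th : x y / x * y} -> (exists x, th (x * x) != 1) ->
  injective th.
Proof.
move=> T5 thM [x0 nx0].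
pose f := @Morphism _ _ [set: {perm T}] th (fun x y _ _ => thM x y).
have kN : 'ker f :&: 'Alt_T <| 'Alt_T.
  rewrite /normal finset.subsetIr /= normsI ?normG //.
  by apply: (fintype.subset_trans (finset.subsetT _)); exact: ker_norm.
have inj1 : forall x, th x = 1 -> x = 1.
  move=> x thx; have kx : x \in 'ker f by apply/kerP; rewrite ?inE.
  have [_ /(_ _ kN)[|] E] := simpleP _ (simple_Alt5 T5).
    apply: central_perm1 => [|y]; first by apply: leq_trans T5.
    suff : [~ x, y] \in 'ker f :&: 'Alt_T.
      rewrite E => /finset.set1P c1; rewrite commgC c1 mulg1 //.
    rewrite finset.in_setI Alt_even; apply/andP; split.
      rewrite commgEl groupMl ?groupV // memJ_norm //.
      by apply: (fintype.subsetP (ker_norm f)); rewrite inE.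
    rewrite commgEl odd_permM odd_permV odd_permJ; by case: (odd_perm x).
  exfalso; move/eqP: nx0; apply.
  have : x0 * x0 \in 'Alt_T by rewrite Alt_even odd_permM; case: odd_perm.
  by rewrite -E => /finset.setIP[/kerP K _]; apply: K; rewrite inE.
move=> x y E.
have th1 : th 1 = 1 by apply: (mulgI (th 1)); rewrite -thM !mulg1.
apply: (mulIg y^-1); rewrite mulgV; apply: inj1.
by rewrite thM E -thM mulgV th1.
Qed.

(** The product of two transpositions has order 1, 2 or 3.  This identity
    distinguishes transpositions from other involutions, see
    [not_tperm_mul6]. *)
Lemma tperm_mul6 (T : finType) (a b c d : T) : (tperm a b * tperm c d) ^+ 6 = 1.
Proof.
set s := tperm a b; set t := tperm c d.
have ss : s * s = 1 by rewrite /s tperm2.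
have tt : t * t = 1 by rewrite /t tperm2.
have [c2|c3] : (s * t) ^+ 2 = 1 \/ (s * t) ^+ 3 = 1; last first.
- by rewrite (expgnA _ 3 2) c3 expg1n.
- by rewrite (expgnA _ 2 3) c2 expg1n.
have expg2 (x : {perm T}) : x ^+ 2 = x * x by [].
have expg3 (x : {perm T}) : x ^+ 3 = x * x * x by rewrite !expgS expg0 mulg1 mulgA.
have [E|nE] := eqVneq (s * t) (t * s).
  by left; rewrite expg2 {2}E mulgA -(mulgA s) tt mulg1.
right.
suff E : t ^ s = s ^ t.
  rewrite expg3; have sV : s^-1 = s by rewrite /s tpermV.
  have tV : t^-1 = t by rewrite /t tpermV.
  move: E; rewrite !conjgE sV tV => E.
  have -> : s * t * (s * t) * (s * t) = s * (t * s) * (t * (s * t)).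
    by rewrite !mulgA.
  by rewrite E -!mulgA (mulgA t t) tt mul1g (mulgA s s) ss mul1g tt.
have [ab|nab] := eqVneq a b.
  by case/eqP: nE; rewrite /s ab tperm1 mul1g mulg1.
have [cd|ncd] := eqVneq c d.
  by case/eqP: nE; rewrite /t cd tperm1 mul1g mulg1.
rewrite /s /t !tpermJ.
have [ac|nac] := eqVneq a c.
  subst c; rewrite !tpermL; have [bd|nbd] := eqVneq b d.
    by subst d; rewrite !tpermR tpermC.
  rewrite tpermD // ?(tpermD (z := b)) //; [exact: tpermC| by rewrite eq_sym].
have [ad|nad] := eqVneq a d.
  subst d; rewrite tpermL tpermR; have [bc|nbc] := eqVneq b c.
    by subst c; rewrite tpermR tpermL tpermC.
  by rewrite !tpermD // 1?eq_sym // tpermC.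
have [bc|nbc] := eqVneq b c.
  subst c; rewrite tpermR tpermL !tpermD // 1?eq_sym //.
have [bd|nbd] := eqVneq b d.
  by subst d; rewrite !tpermR !tpermD // 1?eq_sym // tpermC.
case/eqP: nE.
have ts : t ^ s = t by rewrite /s /t tpermJ !tpermD.
by rewrite (conjgC t s) ts.
Qed.

(** Conjugating by a cycle through one point of each of several orbits of u
    links these orbits into a path or into a ring, on which the product of the
    two involutions is a long cycle.  With two 2-cycles and a fixed point the
    path gives a 5-cycle; without further fixed points a ring of four 2-cycles
    gives two 4-cycles. *)
Lemma not_tperm_mul6 (T : finType) (u : {perm T}) (a c : T) :
  (7 < #|T|)%N -> u * u = 1 -> u a != a -> u c != c -> c != a -> c != u a ->
  exists g : {perm T}, (u * u ^ g) ^+ 6 != 1.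
Proof.
move=> T8 uu ua uc ca cua.
have uK x : u (u x) = x by rewrite -permM uu perm1.
have uI := can_inj uK.
set b := u a; set d := u c.
have jump (g : {perm T}) x y z : u x = y -> forall y', g y' = y -> g (u y') = z ->
    (u * u ^ g) x = z.
  by move=> <- y' gy <-; rewrite permM -gy permJ.
have iter_neq (v : {perm T}) x y : (v ^+ 6) x = y -> y != x -> v ^+ 6 != 1.
  by move=> vx yx; apply: contraNneq yx => v6; rewrite -vx v6 perm1.
have ab : a != b by rewrite eq_sym.
have cd : c != d by rewrite eq_sym.
have db : d != b by rewrite (inj_eq uI).
have da : d != a by rewrite -(inj_eq uI) uK.
(* The 3-cycle (a c e) sends the orbits a - b, c - d, e to c - b, e - d, a,
   which link them into a path. *)
have [/existsP[e /andP[ee /eqP ue]]|nfix] :=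
    boolP [exists e, (e \notin [:: a; b; c; d]) && (u e == e)].
  move: ee; rewrite !inE !negb_or => /and4P[ea eb ec ed].
  pose g := tperm a c * tperm a e.
  have ga : g a = c by rewrite permM tpermL tpermD // eq_sym.
  have gc : g c = e by rewrite permM tpermR tpermL.
  have ge : g e = a by rewrite permM (tpermD (z := e)) ?tpermR // eq_sym.
  have gb : g b = b by rewrite permM !tpermD // 1?eq_sym // .
  have gd : g d = d by rewrite permM !tpermD // 1?eq_sym.
  exists g; set v := u * _.
  have v1 : v a = c by apply: (jump g a b c erefl b gb); rewrite uK.
  have v2 : v c = e by apply: (jump g c d e erefl d gd); rewrite uK.
  have v3 : v e = d by apply: (jump g e e d ue c gc).
  have v4 : v d = b by apply: (jump g d c b (uK c) a ga).
  have v5 : v b = a by apply: (jump g b a a (uK a) e ge); rewrite ue.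
  apply: (iter_neq v a c); last by [].
  by rewrite permX /= v1 v2 v3 v4 v5.
have nf x : x \notin [:: a; b; c; d] -> u x != x.
  by move: nfix; rewrite negb_exists => /forallP/(_ x); case: (x \notin _).
have [e ee] := @exists_fresh T [:: a; b; c; d] (leq_trans (isT : 4 < 8)%N T8).
set f := u e.
have ef : f != e by apply: nf.
move: (ee); rewrite !inE !negb_or => /and4P[ea eb ec ed].
have [h hh] := @exists_fresh T [:: a; b; c; d; e; f] (leq_trans (isT : 6 < 8)%N T8).
move: (hh); rewrite !inE !negb_or => /andP[ha /and5P[hb hc hd he hf]].
set k := u h.
have kh : k != h by apply: nf; rewrite !inE !negb_or ha hb hc hd.
have uneq' x y : u x != y -> x != u y by rewrite -(inj_eq uI) uK.
(* The 4-cycle (a c e h) sends the orbits a - b, c - d, e - f, h - k to c - b,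
   e - d, h - f, a - k, which link them into a ring. *)
pose g := tperm a c * tperm a e * tperm a h.
have ga : g a = c by rewrite !permM tpermL !tpermD // eq_sym.
have gc : g c = e by rewrite !permM tpermR tpermL tpermD // eq_sym.
have ge : g e = h by rewrite !permM (tpermD (z := e)) ?tpermR ?tpermL // eq_sym.
have gh : g h = a.
  by rewrite !permM (@tpermD _ a c h) ?(@tpermD _ a e h) ?tpermR // 1?eq_sym.
have gb : g b = b by rewrite !permM !tpermD // 1?eq_sym.
have gd : g d = d by rewrite !permM !tpermD // 1?eq_sym.
have gf : g f = f.
  have af : a != f by apply: uneq'; rewrite eq_sym.
  have cf : c != f by apply: uneq'; rewrite eq_sym.
  by rewrite !permM !tpermD // eq_sym.
exists g; set v := u * _.
have v1 : v a = c by apply: (jump g a b c erefl b gb); rewrite uK.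
have v2 : v c = e by apply: (jump g c d e erefl d gd); rewrite uK.
have v3 : v e = h by apply: (jump g e f h erefl f gf); rewrite uK.
have v4 : v h = a.
  apply: (jump g h k a erefl k _ _); last by rewrite uK.
  by rewrite !permM !tpermD //; apply: uneq' => //; rewrite eq_sym.
apply: (iter_neq v a e); last by [].
by rewrite permX /= v1 v2 v3 v4 v1 v2.
Qed.

(** The image of a transposition is an involution whose product with any of
    its conjugates has order dividing 6, because the conjugators are in the
    image too. *)
Lemma perm_endo_tperm (T : finType) (th : {perm T} -> {perm T}) (p q : T) :
  (7 < #|T|)%N -> {morph th : x y / x * y} -> injective th -> p != q ->
  exists a b, a != b /\ th (tperm p q) = tperm a b.
Proof.
move=> T8 thM thI pq; set u := th _.
have th1 : th 1 = 1 by apply: (mulgI (th 1)); rewrite -thM !mulg1.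
have thX x k : th (x ^+ k) = th x ^+ k.
  by elim: k => [|k IH]; rewrite ?expg0 // !expgS thM IH.
have thV x : th x^-1 = (th x)^-1.
  by apply: (mulgI (th x)); rewrite -thM !mulgV.
have uu : u * u = 1 by rewrite -thM tperm2 th1.
have uK x : u (u x) = x by rewrite -permM uu perm1.
have [a ua] : exists a, u a != a.
  apply/existsP; rewrite -negb_forall; apply/negP => /forallP uid.
  have : tperm p q = 1.
    by apply: thI; rewrite th1; apply/permP => x; rewrite perm1; apply/eqP/uid.
  by move/permP/(_ p); rewrite tpermL perm1 => /eqP; rewrite eq_sym (negPf pq).
have [/existsP[c /and3P[uc ca cua]]|none] :=
    boolP [exists c, [&& u c != c, c != a & c != u a]].
  have [g /eqP[]] := not_tperm_mul6 T8 uu ua uc ca cua.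
  have [h _ hK] := injF_bij thI.
  rewrite -(hK g) conjgE /u -thV -!thM -conjgE -thX tpermJ tperm_mul6.
  exact: th1.
exists a, (u a); split; first by rewrite eq_sym.
apply/permP => x; case: tpermP => [-> //|->|xa xb]; first exact: uK.
apply/eqP; move: none; rewrite negb_exists => /forallP/(_ x).
by rewrite !negb_and !negbK; case/or3P=> // /eqP.
Qed.

Lemma tperm_commute (T : finType) (a b c d : T) :
  a != c -> a != d -> b != c -> b != d ->
  tperm a b * tperm c d = tperm c d * tperm a b.
Proof.
move=> ac ad bc bd; rewrite (conjgC (tperm c d)) tpermJ.
by rewrite !(@tpermD _ a b).
Qed.

(** An endomorphism that does not kill all squares is conjugation by a
    permutation.  The transpositions moving a given point form a star of pairwise
    noncommuting transpositions with more than three members; their images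
    pairwise intersect too and do not form a triangle, so they share a point,
    which is the image of the given one.  The bound 8 is what [not_tperm_mul6]
    needs; the statement fails in degree 6. *)
Lemma perm_endo_inner (T : finType) (th : {perm T} -> {perm T}) :
  (7 < #|T|)%N -> {morph th : x y / x * y} -> (exists x, th (x * x) != 1) ->
  exists pi : {perm T}, forall x, th x = x ^ pi.
Proof.
move=> T8 thM thx; have thI := perm_endo_inj (leq_trans (isT : 4 < 8)%N T8) thM thx.
have th1 : th 1 = 1 by apply: (mulgI (th 1)); rewrite -thM !mulg1.
have thV x : th x^-1 = (th x)^-1.
  by apply: (mulgI (th x)); rewrite -thM !mulgV.
have thJ x y : th (x ^ y) = th x ^ th y by rewrite !conjgE !thM thV.
have [p0 _] := @exists_fresh T [::] (leq_trans (isT : 0 < 8)%N T8).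
have [q] := @exists_fresh T [:: p0] (leq_trans (isT : 1 < 8)%N T8).
rewrite inE => qp0.
have [r] := @exists_fresh T [:: p0; q] (leq_trans (isT : 2 < 8)%N T8).
rewrite !inE negb_or => /andP[rp0 rq].
have thT s t : s != t -> exists a b, a != b /\ th (tperm s t) = tperm a b.
  exact: perm_endo_tperm.
(* Two transpositions that do not commute share a point, and so do their images. *)
have noncomm s t : s != p0 -> t != p0 -> s != t ->
    th (tperm p0 s) * th (tperm p0 t) <> th (tperm p0 t) * th (tperm p0 s).
  move=> sp tp st; rewrite -!thM => /thI/permP/(_ p0).
  rewrite !permM !tpermL !tpermD // 1?eq_sym //.
  by move/eqP; rewrite (negPf st).
have [a [b [c [ab ac bc Eq Er]]]] : exists a b c, [/\ a != b, a != c, b != c,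
    th (tperm p0 q) = tperm a b & th (tperm p0 r) = tperm a c].
  have [a [b [ab Eq]]] := thT p0 q (ltac:(by rewrite eq_sym)).
  have [c [d [cd Er]]] := thT p0 r (ltac:(by rewrite eq_sym)).
  have nc := noncomm q r qp0 rp0 (ltac:(by rewrite eq_sym)).
  rewrite Eq Er in nc.
  have nE x y z t : tperm a b = tperm x y -> tperm c d = tperm z t ->
      ~ (x = z /\ y = t).
    by move=> E1 E2 [xz yt]; apply: nc; rewrite E1 E2 xz yt.
  have [ac|nac] := eqVneq a c.
    subst c; exists a, b, d; split=> //; apply/eqP => bd; subst d.
    exact: (nE _ _ _ _ erefl erefl (conj erefl erefl)).
  have [ad|nad] := eqVneq a d.
    have bc : b != c.
      apply/eqP => bc; subst d c.
      exact: (nE a b a b erefl (tpermC _ _) (conj erefl erefl)).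
    by subst d; exists a, b, c; split=> //; rewrite 1?eq_sym // Er tpermC.
  have [bc|nbc] := eqVneq b c.
    by subst c; exists b, a, d; split=> //; rewrite 1?eq_sym // Eq tpermC.
  have [bd|nbd] := eqVneq b d.
    subst d; exists b, a, c; split=> //; rewrite 1?eq_sym //.
      by rewrite Eq tpermC.
    by rewrite Er tpermC.
  by case: nc; apply: tperm_commute.
have star s : exists s', th (tperm p0 s) = tperm a s'.
  have [->|sp0] := eqVneq s p0; first by exists a; rewrite !tperm1.
  have [->|sq] := eqVneq s q; first by exists b.
  have [->|sr] := eqVneq s r; first by exists c.
  have [d [e [de Es]]] := thT p0 s (ltac:(by rewrite eq_sym)).
  have [ad|nad] := eqVneq a d; first by exists e; rewrite ad.
  have [ae|nae] := eqVneq a e; first by exists d; rewrite Es ae tpermC.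
  have mem x : x != a -> (tperm a x = th (tperm p0 q) \/ tperm a x = th (tperm p0 r)) ->
      x = d \/ x = e.
    move=> xa H; have [-> |xd] := eqVneq x d; first by left.
    have [->|xe] := eqVneq x e; first by right.
    have C := tperm_commute nad nae xd xe; rewrite -Es in C.
    exfalso; move: C.
    by case: H => ->; [apply: (noncomm q s)|apply: (noncomm r s)]; rewrite // eq_sym.
  have bin : b = d \/ b = e by apply: mem; [rewrite eq_sym|left].
  have cin : c = d \/ c = e by apply: mem; [rewrite eq_sym|right].
  have dec : tperm d e = tperm b c.
    case: bin cin bc => [->|->] [->|->] //; rewrite ?eqxx //.
    by rewrite tpermC.
  (* The third side of the triangle is the image of (q r). *)
  have : th (tperm q r) = th (tperm p0 s).
    have -> : tperm q r = tperm p0 q ^ tperm p0 r.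
      by rewrite tpermJ tpermL tpermD ?(eq_sym p0) // tpermC.
    rewrite thJ Eq Er Es dec tpermJ tpermL (@tpermD _ a c b) // ?(eq_sym c b) //.
    by rewrite tpermC.
  move/thI/permP/(_ s); rewrite tpermR tpermD 1?eq_sym // => /eqP.
  by rewrite (negPf sp0).
have [pi0 pi0E] : exists pi0 : T -> T, forall s, th (tperm p0 s) = tperm a (pi0 s).
  exists (fun s => odflt a [pick s' | th (tperm p0 s) == tperm a s']) => s.
  case: pickP => [x /eqP //|none]; have [s' E] := star s.
  by move: (none s'); rewrite E eqxx.
have pip0 : pi0 p0 = a.
  apply/eqP; apply/negPn/negP => na; move: (pi0E p0).
  rewrite tperm1 th1 => /permP/(_ a); rewrite perm1 tpermL => /eqP.
  by rewrite eq_sym (negPf na).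
have piI : injective pi0.
  move=> s t st; have /thI/permP/(_ p0) : th (tperm p0 s) = th (tperm p0 t).
    by rewrite !pi0E st.
  by rewrite !tpermL.
exists (perm piI).
have thT' s t : th (tperm s t) = tperm (pi0 s) (pi0 t).
  have [->|sp] := eqVneq s p0; first by rewrite pi0E pip0.
  have [->|tp] := eqVneq t p0; first by rewrite tpermC pi0E pip0 tpermC.
  have [->|st] := eqVneq s t; first by rewrite !tperm1 th1.
  have -> : tperm s t = tperm p0 s ^ tperm p0 t.
    by rewrite tpermJ tpermL tpermD 1?eq_sym // tpermC.
  rewrite thJ !pi0E tpermJ tpermL tpermD ?(inj_eq piI) 1?eq_sym //.
    by rewrite tpermC.
  by rewrite -pip0 (inj_eq piI).
move=> x; have [ts -> _] := prod_tpermP x.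
elim: ts => [|t ts IH]; first by rewrite !big_nil th1 conj1g.
by rewrite !big_cons thM IH thT' conjMg tpermJ !permE.
Qed.

(** * Local rules of the elements of the stabilized group *)

Section Basics.
Variable n : nat.
Implicit Types (x y : fullshift n) (f g : autinf n).

Lemma autinfM f g x : (f * g) x = f (g x). Proof. by []. Qed.
Lemma autinf1 x : (1 : autinf n) x = x. Proof. by []. Qed.
Lemma autinfK f x : f^-1 (f x) = x. Proof. by rewrite -autinfM mulVg. Qed.
Lemma autinfVK f x : f (f^-1 x) = x. Proof. by rewrite -autinfM mulgV. Qed.
Lemma autinf_inj f : injective f. Proof. exact: can_inj (autinfK f). Qed.
Lemma autinf_eqP f g : (forall x, f x = g x) -> f = g.
Proof. by move=> fg; apply/val_inj/val_inj/bijectionP. Qed.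

Definition translate (j : int) (x : fullshift n) : fullshift n := fun i => x (i + j)%R.

Lemma translateD j k x : translate j (translate k x) = translate (j + k)%R x.
Proof. by apply: funext => i; rewrite /translate addrA. Qed.
Lemma translate0 x : translate 0 x = x.
Proof. by apply: funext => i; rewrite /translate addr0. Qed.

Lemma translateK j : cancel (translate j) (translate (- j)%R).
Proof. by move=> x; rewrite translateD addNr translate0. Qed.

Lemma sigmaXE k x : (sigma n ^+ k) x = translate k%:Z x.
Proof.
elim: k => [|k IH] in x *; first by rewrite expg0 autinf1 translate0.
rewrite expgS autinfM IH; apply: funext => i.
by rewrite [LHS]/(translate _ _ _) /translate; congr (x _); lia.
Qed.

Lemma sigmaXVE k x : ((sigma n ^+ k)^-1 : autinf n) x = translate (- Posz k)%R x.
Proof.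
apply: (@autinf_inj (sigma n ^+ k)).
by rewrite autinfVK sigmaXE translateD subrr translate0.
Qed.

Lemma aut_shiftP k f :
  aut_shift k f <-> forall x, f (translate k%:Z x) = translate k%:Z (f x).
Proof.
split=> [/aut_shiftE fk x|fk].
  by rewrite -!sigmaXE -!autinfM fk.
by apply/aut_shiftE/autinf_eqP => x; rewrite !autinfM !sigmaXE.
Qed.

Definition agree (r : nat) (i : int) x y :=
  forall j, (i - r%:Z <= j <= i + r%:Z)%R -> x j = y j.

Lemma nbhs_coord (s : seq int) x :
  nbhs x [set y : fullshift n | forall j, j \in s -> x j = y j].
Proof.
elim: s => [|i s IH];
    first exact: (@filterS _ _ (nbhs_filter x) setT _ _ (@filterT _ _ (nbhs_filter x))).
have ni : nbhs x [set y : fullshift n | x i = y i].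
  by apply: (@proj_continuous int (fun=> discrete_topology 'I_n) i x [set a | x i = a]).
apply: (@filterS _ _ (nbhs_filter x) _ _ _ (@filterI _ _ (nbhs_filter x) _ _ ni IH)).
by move=> y [yi ys] j; rewrite inE => /predU1P[->|/ys].
Qed.

Lemma nbhs_agree r i x : nbhs x [set y : fullshift n | agree r i x y].
Proof.
pose s := [seq (i - r%:Z + k%:Z)%R | k <- iota 0 (r + r).+1].
apply: (@filterS _ _ (nbhs_filter x) _ _ _ (nbhs_coord s x)) => y ys j jr.
apply: ys; apply/mapP; exists (absz (j - (i - r%:Z))%R); last by lia.
by rewrite mem_iota; lia.
Qed.

(** The filter generated by the windows around the origin converges in each
    coordinate, hence for the product topology. *)
Lemma agree_basis x (U : set (fullshift n)) :
  nbhs x U -> exists r, forall y, agree r 0 x y -> U y.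
Proof.
pose F : set_system (fullshift n) :=
  [set V | exists r, [set y | agree r 0 x y] `<=` V].
have FF : Filter F.
  split; first by exists 0%N.
  - move=> V W [r rV] [s sW]; exists (r + s)%N => y xy.
    by split; [apply: rV|apply: sW] => j jr; apply: xy; lia.
  - by move=> V W VW [r rV]; exists r => y /rV/VW.
suff: F --> x by move=> Fx /Fx.
apply/cvg_sup => i V [W [[Z oZ <-] Zx ZV]].
exists `|i|%N => y xy; apply: ZV; rewrite /= -xy //; lia.
Qed.

Definition has_radius (r : nat) (f : fullshift n -> fullshift n) :=
  forall i x y, agree r i x y -> f x i = f y i.

Lemma fullshift_compact : compact [set: fullshift n].
Proof.
have := @tychonoff int (fun=> discrete_topology 'I_n) (fun=> setT).
rewrite (_ : [set f | _] = setT); last by rewrite eqEsubset; split.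
by apply => _; apply: finite_compact; apply: finite_finset.
Qed.

(** Near-covering compactness for the filter of large radii turns the
    local constancy of one coordinate into uniform constancy. *)
Lemma coord_radius f i : exists r, forall x y, agree r 0 x y -> f x i = f y i.
Proof.
pose F : set_system nat := [set V | exists N, forall r, (N <= r)%N -> V r].
have FF : Filter F.
  split; first by exists 0%N.
  - move=> V W [a aV] [b bW]; exists (a + b)%N => r rab.
    by split; [apply: aV|apply: bW]; lia.
  - by move=> V W VW [a aV]; exists a => r /aV/VW.
have cf : continuous (f : fullshift n -> fullshift n).
  by case: f => -[f fh] /= _; case/asboolP: fh.
have [|N NP] := (compact_near_coveringP [set: fullshift n]).1 fullshift_compact
  nat F (fun r x => forall y, agree r 0 x y -> f x i = f y i) FF.
  move=> x _.
  have [r rP] : exists r, forall y, agree r 0 x y -> f x i = f y i.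
    apply: (@agree_basis x [set y : fullshift n | f x i = f y i]).
    apply: (cf x [set z : fullshift n | f x i = z i]).
    by apply: (@proj_continuous int (fun=> discrete_topology 'I_n) i (f x)
                 [set a | f x i = a]).
  exists ([set x' | agree r 0 x x'], [set s | (r <= s)%N]).
    by split; [exact: nbhs_agree|exists r].
  move=> [x' s] [/= xx' rs] y xy; rewrite -rP //; apply: rP => j jr.
  by rewrite xx' //; apply: xy; lia.
by exists N => x y xy; apply: (NP N (leqnn N)).
Qed.

Lemma has_radiusW r s f : (r <= s)%N -> has_radius r f -> has_radius s f.
Proof. by move=> rs fr i x y xy; apply: fr => j jr; apply: xy; lia. Qed.

Lemma aut_shift_translate k f (q : int) x : aut_shift k f ->
  f (translate (q * k%:Z)%R x) = translate (q * k%:Z)%R (f x).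
Proof.
move=> /aut_shiftP fk.
have nat_case (m : nat) z : f (translate (m%:Z * k%:Z)%R z) =
    translate (m%:Z * k%:Z)%R (f z).
  elim: m => [|m IH] in z *; first by rewrite mul0r !translate0.
  have -> : (m.+1%:Z * k%:Z = k%:Z + m%:Z * k%:Z)%R by lia.
  by rewrite -!translateD fk IH.
case: q => m; first exact: nat_case.
have E z : translate (m.+1%:Z * k%:Z)%R (translate (Negz m * k%:Z)%R z) = z.
  by rewrite translateD (_ : (_ + _)%R = 0%R) ?translate0 //; lia.
apply: (@can_inj _ _ (translate (m.+1%:Z * k%:Z)%R) (translate (Negz m * k%:Z)%R)) => [z|].
  by rewrite translateD (_ : (_ + _)%R = 0%R) ?translate0 //; lia.
by rewrite -nat_case E [RHS]E.
Qed.

(** The theorem of Curtis, Hedlund and Lyndon; commuting with a power of the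
    shift reduces the coordinates to finitely many. *)
Lemma exists_radius f : exists r, has_radius r f.
Proof.
have [k [k0 fk]] := period_exists f.
have [r rP] : exists r, forall i : nat, (i < k)%N -> forall x y, agree r 0 x y ->
    f x (Posz i) = f y (Posz i).
  elim: {k0 fk} k => [|k [r rP]]; first by exists 0%N.
  have [s sP] := coord_radius f (Posz k).
  exists (r + s)%N => i; rewrite ltnS leq_eqVlt => /predU1P[->|ik] x y xy.
    by apply: sP => j jr; apply: xy; lia.
  by apply: rP => // j jr; apply: xy; lia.
exists (r + k)%N => i x y xy.
have [q [m [mk iE]]] : exists q (m : nat), (m < k)%N /\ (i = m%:Z + q * k%:Z)%R.
  by exists (i %/ k%:Z)%Z, `|(i %% k%:Z)%Z|%N; split; lia.
have step z : f z i = f (translate (q * k%:Z)%R z) (Posz m).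
  by rewrite aut_shift_translate ?iE.
rewrite !step; apply: rP => // j jr; apply: xy; lia.
Qed.

Lemma common_radius f : exists r, has_radius r f /\ has_radius r (f^-1)%g.
Proof.
have [r rf] := exists_radius f; have [s sf] := exists_radius (f^-1)%g.
by exists (r + s)%N; split; [apply: has_radiusW rf|apply: has_radiusW sf]; lia.
Qed.

Lemma local_continuous (h : fullshift n -> fullshift n) :
  (forall i, exists r, forall x y, agree r i x y -> h x i = h y i) -> continuous h.
Proof.
move=> hl x; apply/cvg_sup; first exact/fmap_filter/(nbhs_filter x).
move=> i U [V [[W oW <-] Wx VU]]; have [r rP] := hl i.
apply: (@filterS _ _ (nbhs_filter x) _ _ _ (nbhs_agree r i x)) => y xy.
by apply: VU; rewrite /= -(rP x).
Qed.

Lemma build_autinf (h h' : fullshift n -> fullshift n) (k : nat) :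
  (0 < k)%N -> cancel h h' -> cancel h' h ->
  (forall i, exists r, forall x y, agree r i x y -> h x i = h y i) ->
  (forall i, exists r, forall x y, agree r i x y -> h' x i = h' y i) ->
  (forall x, h (translate k%:Z x) = translate k%:Z (h x)) ->
  exists f, (forall x, f x = h x) /\ aut_shift k f.
Proof.
move=> k0 hK h'K hl h'l hk.
have hh : is_homeo (Bijection hK h'K).
  by apply/asboolP; split; apply: local_continuous.
have hc : aut_shift k (Homeo hh).
  apply/val_inj/bijectionP => x; rewrite -val_sigmaX.
  change (h ((sigma n ^+ k) x) = (sigma n ^+ k) (h x)).
  by rewrite !sigmaXE.
have hG : Homeo hh \in @autinf_set n by apply/mem_set; exists k.
by exists (AutInf hG).
Qed.

(** A period, a radius and the finite table of values at the coordinates of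
    one period determine the map. *)
Lemma autinf_code : exists c : autinf n -> nat, injective c.
Proof.
pose rad f := projT1 (cid (exists_radius f)).
have radP f : has_radius (rad f) f by rewrite /rad; case: cid.
pose patch r (m : int) (p : {ffun 'I_(r + r).+1 -> 'I_n}) : fullshift n :=
  fun j => p (inord (absz (j - m + r%:Z)%R)).
pose rule k r f := [ffun i : 'I_k => [ffun p => f (patch r (Posz i) p) (Posz i)]].
pose c f := pickle (period f, rad f, pickle (rule (period f) (rad f) f)).
exists c => f g /(pcan_inj pickleK)[pE rE].
have := radP f; have := radP g; have := period_aut f; have := period_aut g.
have := period_gt0 f; rewrite -pE -rE.
set k := period f; set r := rad f => k0 gk fk gr fr /(pcan_inj pickleK)/ffunP rule_eq.
apply: autinf_eqP => x; apply: funext => i.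
have [q [m [mk iE]]] : exists q (m : nat), (m < k)%N /\ (i = m%:Z + q * k%:Z)%R.
  by exists (i %/ k%:Z)%Z, `|(i %% k%:Z)%Z|%N; split; lia.
set x' := translate (q * k%:Z)%R x.
have step (h : autinf n) : aut_shift k h -> h x i = h x' (Posz m).
  by move=> hk; rewrite /x' aut_shift_translate ?iE.
rewrite !step //.
pose p := [ffun j : 'I_(r + r).+1 => x' (Posz m - r%:Z + (nat_of_ord j)%:Z)%R].
have xp : agree r (Posz m) x' (patch r (Posz m) p).
  move=> j jr; rewrite /patch ffunE inordK; last by lia.
  by congr (x' _); lia.
rewrite (fr _ _ _ xp) (gr _ _ _ xp).
by have := rule_eq (Ordinal mk); rewrite !ffunE => /ffunP/(_ p); rewrite !ffunE.
Qed.

End Basics.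

(** * Block gates and their action on periodic points *)

Section Blocks.
Variables (n k : nat).
Implicit Types (x y : fullshift n) (f g : autinf n).

Definition per : int := Posz k.+1.
Definition word := {ffun 'I_k.+1 -> 'I_n}.
Implicit Types (w : word) (s t : {perm word}).

Definition phase (i : int) : 'I_k.+1 := inord (absz (i %% per)%Z).
Definition block x (q : int) : word := [ffun r : 'I_k.+1 => x (q * per + Posz r)%R].
Definition periodize w : fullshift n := fun i => w (phase i).
Definition periodic x := translate per x = x.

Lemma phaseE i : Posz (phase i) = (i %% per)%Z.
Proof. by rewrite /phase inordK /per; lia. Qed.

Lemma phaseD i q : phase (i + q * per)%R = phase i.
Proof. by rewrite /phase addrC modzMDl. Qed.

Lemma phase_ord q (r : 'I_k.+1) : phase (q * per + Posz r)%R = r.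
Proof.
apply: val_inj; apply/eqP; rewrite -eqz_nat phaseE modzMDl modz_small //.
by rewrite /per; have := ltn_ord r; lia.
Qed.

Lemma quot_ord q (r : 'I_k.+1) : ((q * per + Posz r) %/ per)%Z = q.
Proof.
rewrite divzMDl // divz_small ?addr0 //.
by rewrite /per; have := ltn_ord r; lia.
Qed.

Lemma blockE x i : block x (i %/ per)%Z (phase i) = x i.
Proof. by rewrite ffunE phaseE; congr (x _); rewrite /per; lia. Qed.

Lemma periodicX x q : periodic x -> translate (q * per)%R x = x.
Proof.
move=> px; have nat_case (m : nat) : translate (m%:Z * per)%R x = x.
  elim: m => [|m IH]; first by rewrite mul0r translate0.
  by rewrite (_ : (_ * _)%R = (m%:Z * per + per)%R) -?translateD ?px ?IH //; lia.
case: q => m; first exact: nat_case.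
by rewrite -{1}(nat_case m.+1) translateD (_ : (_ + _)%R = 0%R) ?translate0 //; lia.
Qed.

Lemma periodicE x i j : periodic x -> (i %% per = j %% per)%Z -> x i = x j.
Proof.
move=> px ij; rewrite -[in LHS](periodicX (- (i %/ per)%Z + (j %/ per)%Z)%R px).
by rewrite /translate; congr (x _); move: ij; rewrite /per; lia.
Qed.

Lemma periodize_periodic w : periodic (periodize w).
Proof.
by apply: funext => i; rewrite /translate /periodize -{1}[per]mul1r phaseD.
Qed.

Lemma block_periodize w q : block (periodize w) q = w.
Proof.
by apply/ffunP => r; rewrite ffunE /periodize phase_ord.
Qed.

Lemma periodize_block x : periodic x -> periodize (block x 0) = x.
Proof.
move=> px; apply: funext => i; rewrite /periodize ffunE phaseE mul0r add0r.
by apply: periodicE; rewrite // modz_mod.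
Qed.

Definition gate_fun s x : fullshift n := fun i => s (block x (i %/ per)%Z) (phase i).

Lemma block_gate_fun s x q : block (gate_fun s x) q = s (block x q).
Proof.
by apply/ffunP => r; rewrite ffunE /gate_fun quot_ord phase_ord.
Qed.

Lemma gate_funM s t x : gate_fun (s * t) x = gate_fun t (gate_fun s x).
Proof. by apply: funext => i; rewrite /gate_fun permM block_gate_fun. Qed.

Lemma gate_fun1 x : gate_fun 1 x = x.
Proof. by apply: funext => i; rewrite /gate_fun perm1 blockE. Qed.

Lemma block_translate x q j : block (translate (j * per)%R x) q = block x (q + j)%R.
Proof. by apply/ffunP => r; rewrite !ffunE /translate; congr (x _); lia. Qed.

Lemma gate_exists s : exists f, (forall x, f x = gate_fun s x) /\ aut_shift k.+1 f.
Proof.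
have gl t i : exists r, forall x y, agree r i x y -> gate_fun t x i = gate_fun t y i.
  exists k.+1 => x y xy; rewrite /gate_fun; congr (t _ _).
  apply/ffunP => r; rewrite !ffunE; have := ltn_ord r => rk; apply: xy.
  by rewrite /per; lia.
apply: (@build_autinf _ (gate_fun s) (gate_fun s^-1)) => //.
- by move=> x; rewrite -gate_funM mulgV gate_fun1.
- by move=> x; rewrite -gate_funM mulVg gate_fun1.
move=> x; apply: funext => i; rewrite /translate /gate_fun -/per.
have -> : phase (i + per)%R = phase i by rewrite -(phaseD i 1) mul1r.
have -> : ((i + per)%R %/ per)%Z = ((i %/ per)%Z + 1)%R by rewrite divzDr ?dvdzz // divzz.
by rewrite -block_translate mul1r.
Qed.

Definition gate s : autinf n := projT1 (cid (gate_exists s)).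
Lemma gateE s x : gate s x = gate_fun s x.
Proof. by rewrite /gate; case: cid => f []. Qed.
Lemma gate_aut s : aut_shift k.+1 (gate s).
Proof. by rewrite /gate; case: cid => f []. Qed.

(** The order is reversed because permutations act on the right and
    elements of the stabilized group on the left. *)
Lemma gateM s t : gate (s * t) = gate t * gate s.
Proof. by apply: autinf_eqP => x; rewrite autinfM !gateE gate_funM. Qed.

Lemma aut_periodic f x : aut_shift k.+1 f -> periodic x -> periodic (f x).
Proof. by move=> /aut_shiftP fk px; rewrite /periodic -fk px. Qed.

(** By [blockwise_gate] such a map is a block gate; this is how maps obtained
    by conjugation are recognized as gates. *)
Definition blockwise f := aut_shift k.+1 f /\
  forall x y, block x 0 = block y 0 -> block (f x) 0 = block (f y) 0.

Lemma word_perm_inj f : aut_shift k.+1 f ->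
  injective (fun w => block (f (periodize w)) 0).
Proof.
move=> fk w w' /(congr1 periodize).
rewrite !periodize_block; try exact/aut_periodic/periodize_periodic.
by move=> /autinf_inj/(congr1 (block^~ 0)); rewrite !block_periodize.
Qed.

(** The action of Aut(sigma^(k+1)) on its n^(k+1) periodic points, seen as
    words.  Outside Aut(sigma^(k+1)) the value is a default. *)
Definition word_perm f : {perm word} :=
  if pselect (aut_shift k.+1 f) is left fk then perm (word_perm_inj fk) else 1.

Lemma word_permE f w : aut_shift k.+1 f ->
  periodize (word_perm f w) = f (periodize w).
Proof.
rewrite /word_perm; case: pselect => // fk _.
by rewrite permE periodize_block //; apply/aut_periodic/periodize_periodic.
Qed.

Lemma periodize_inj : injective periodize.
Proof. by move=> w w' /(congr1 (block^~ 0)); rewrite !block_periodize. Qed.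

Lemma aut_shiftM f g : aut_shift k.+1 f -> aut_shift k.+1 g -> aut_shift k.+1 (f * g).
Proof. by move=> /aut_shiftP fk /aut_shiftP gk; apply/aut_shiftP => x;
    rewrite !autinfM gk fk. Qed.
Lemma aut_shiftV f : aut_shift k.+1 f -> aut_shift k.+1 (f^-1 : autinf n).
Proof.
move=> /aut_shiftP fk; apply/aut_shiftP => x.
by rewrite -{1}(autinfVK f x) -fk autinfK.
Qed.

Lemma word_permM f g : aut_shift k.+1 f -> aut_shift k.+1 g ->
  word_perm (f * g) = word_perm g * word_perm f.
Proof.
move=> fk gk; apply/permP => w; apply: periodize_inj.
by rewrite permM !word_permE //; apply: aut_shiftM.
Qed.

Lemma word_perm_gate s : word_perm (gate s) = s.
Proof.
apply/permP => w; apply: periodize_inj; rewrite word_permE; last exact: gate_aut.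
rewrite gateE; apply: funext => i.
by rewrite /gate_fun block_periodize.
Qed.

Lemma blockwise_gate f : blockwise f -> f = gate (word_perm f).
Proof.
move=> [fk fb]; apply: autinf_eqP => x; rewrite gateE; apply: funext => i.
set q := (i %/ per)%Z; set x' := translate (q * per)%R x.
have -> : f x i = block (f x') 0 (phase i).
  rewrite ffunE phaseE /x' aut_shift_translate // /translate.
  by congr (f x _); rewrite /q /per; lia.
rewrite (fb x' (periodize (block x q))); last first.
  by rewrite block_periodize block_translate add0r.
by rewrite -word_permE // block_periodize.
Qed.

End Blocks.

(** * Permutations of two neighbouring cells *)

Section PairGates.
Variables (n k : nat).
Hypothesis k0 : (0 < k)%N.
Local Notation M := (per k).
Implicit Types (x y : fullshift n) (f g : autinf n) (s t : {perm 'I_n * 'I_n}).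

Lemma modz_rem (q r : int) : (0 <= r < M)%R -> ((q * M + r)%R %% M)%Z = r.
Proof. by move=> rM; rewrite modzMDl modz_small. Qed.

Lemma modz_decomp (i : int) : exists q r : int, (i = q * M + r)%R /\ (0 <= r < M)%R.
Proof.
exists (i %/ M)%Z, (i %% M)%Z; split; first exact: divz_eq.
by rewrite modz_ge0 // ltz_pmod.
Qed.

(** Applies s to the cells i and i + 1 for every i congruent to a.  The pair may
    straddle the boundary of an aligned block, so this need not be a block
    gate. *)
Definition pair_fun (a : int) s x : fullshift n := fun i =>
  if ((i - a)%R %% M)%Z == 0%R then (s (x i, x (i + 1)%R)).1
  else if ((i - a)%R %% M)%Z == 1%R then (s (x (i - 1)%R, x i)).2
  else x i.

Lemma pair_fun_left a s x q :
  pair_fun a s x (a + q * M)%R = (s (x (a + q * M)%R, x (a + q * M + 1)%R)).1.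
Proof.
rewrite /pair_fun (_ : (_ - _)%R = (q * M + 0)%R); last by lia.
by rewrite modz_rem.
Qed.

Lemma pair_fun_right a s x q :
  pair_fun a s x (a + q * M + 1)%R = (s (x (a + q * M)%R, x (a + q * M + 1)%R)).2.
Proof.
rewrite /pair_fun (_ : (_ - a)%R = (q * M + 1)%R); last by lia.
by rewrite modz_rem //= ?addrK // /per; lia.
Qed.

Lemma pair_fun_out a s x q r : (1 < r < M)%R ->
  pair_fun a s x (a + q * M + r)%R = x (a + q * M + r)%R.
Proof.
move=> rM; rewrite /pair_fun (_ : (_ - a)%R = (q * M + r)%R); last by lia.
rewrite modz_rem; last by lia.
by case: ifP => [/eqP E|_]; [lia|case: ifP => // /eqP E; lia].
Qed.

Lemma pair_cases (P : int -> Prop) a :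
  (forall q, P (a + q * M)%R) -> (forall q, P (a + q * M + 1)%R) ->
  (forall q r, (1 < r < M)%R -> P (a + q * M + r)%R) -> forall i, P i.
Proof.
move=> P0 P1 Pr i; have [q [r [iE rM]]] := modz_decomp (i - a)%R.
have -> : i = (a + q * M + r)%R by lia.
have [->|r0] := eqVneq r 0%R; first by rewrite addr0.
have [->//|r1] := eqVneq r 1%R.
by apply: Pr; lia.
Qed.

Lemma pair_funM a s t x : pair_fun a (s * t) x = pair_fun a t (pair_fun a s x).
Proof.
apply: funext; apply: (@pair_cases _ a) => [q|q|q r rM].
- by rewrite !pair_fun_left pair_fun_right permM; case: (s _).
- by rewrite !pair_fun_right pair_fun_left permM; case: (s _).
- by rewrite !pair_fun_out.
Qed.

Lemma pair_fun1 a x : pair_fun a 1 x = x.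
Proof.
apply: funext; apply: (@pair_cases _ a) => [q|q|q r rM].
- by rewrite pair_fun_left perm1.
- by rewrite pair_fun_right perm1.
- by rewrite pair_fun_out.
Qed.

Lemma pair_fun_translate a s x j :
  pair_fun a s (translate j x) = translate j (pair_fun (a + j)%R s x).
Proof.
apply: funext => i; rewrite /translate /pair_fun.
have -> : (i + j - (a + j) = i - a)%R by lia.
have -> : (i + j + 1 = i + 1 + j)%R by lia.
by have -> : (i + j - 1 = i - 1 + j)%R by lia.
Qed.

Lemma pair_fun_mod a s x q : pair_fun (a + q * M)%R s x = pair_fun a s x.
Proof.
apply: funext => i; rewrite /pair_fun.
by rewrite (_ : (i - (a + q * M) = (- q) * M + (i - a))%R) ?modzMDl //; lia.
Qed.

Lemma pair_gate_exists a s : exists f, (forall x, f x = pair_fun a s x) /\ aut_shift k.+1 f.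
Proof.
have gl t i : exists r, forall x y, agree r i x y -> pair_fun a t x i = pair_fun a t y i.
  exists 1%N => x y xy; rewrite /pair_fun.
  by rewrite !(xy i) ?(xy (i + 1)%R) ?(xy (i - 1)%R) //; lia.
apply: (@build_autinf _ (pair_fun a s) (pair_fun a s^-1)) => //.
- by move=> x; rewrite -pair_funM mulgV pair_fun1.
- by move=> x; rewrite -pair_funM mulVg pair_fun1.
by move=> x; rewrite -/M pair_fun_translate -[in RHS](pair_fun_mod a s x 1) mul1r.
Qed.

Definition pair_gate a s : autinf n := projT1 (cid (pair_gate_exists a s)).
Lemma pair_gateE a s x : pair_gate a s x = pair_fun a s x.
Proof. by rewrite /pair_gate; case: cid => f []. Qed.
Lemma pair_gate_aut a s : aut_shift k.+1 (pair_gate a s).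
Proof. by rewrite /pair_gate; case: cid => f []. Qed.

Lemma pair_gate_mod a s q : pair_gate (a + q * M)%R s = pair_gate a s.
Proof. by apply: autinf_eqP => x; rewrite !pair_gateE pair_fun_mod. Qed.

Lemma pair_gate_conj (h : nat) a s :
  sigma n ^+ h * pair_gate a s = pair_gate (a - Posz h)%R s * sigma n ^+ h.
Proof.
apply: autinf_eqP => x; rewrite !autinfM !sigmaXE !pair_gateE pair_fun_translate.
by rewrite subrK.
Qed.

Lemma eq_block0 x y : block k x 0 = block k y 0 <->
  forall j, (0 <= j < M)%R -> x j = y j.
Proof.
split=> [/ffunP xy j jM|xy].
  have := xy (phase k j); rewrite !ffunE phaseE mul0r add0r modz_small //.
apply/ffunP => r; rewrite !ffunE mul0r add0r; apply: xy.
by rewrite /per; have := ltn_ord r; lia.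
Qed.

(** Only the residue M - 1 makes the pair straddle two blocks. *)
Lemma pair_gate_blockwise a s : (0 <= a < M - 1)%R -> blockwise k (pair_gate a s).
Proof.
move=> aM; split=> [|x y]; first exact: pair_gate_aut.
rewrite !eq_block0 => xy j jM; rewrite !pair_gateE /pair_fun.
have [q [r [jE rM]]] := modz_decomp (j - a)%R; rewrite jE modz_rem //.
have q1 : (q = 0 \/ q = -1)%R.
  have : (- M < q * M + r < M)%R by lia.
  move=> H; have : (-1 <= q < 1)%R; last by lia.
  by apply/andP; split; nia.
case: ifP => [/eqP r0|_].
  have ja : j = a by case: q1 => qE; subst q; lia.
  by rewrite (xy j) // (xy (j + 1)%R) //; lia.
case: ifP => [/eqP r1|_]; last exact: xy.
have ja : j = (a + 1)%R by case: q1 => qE; subst q; lia.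
by rewrite (xy j) // (xy (j - 1)%R) //; lia.
Qed.

End PairGates.

(** * A permutation of the periodic points implementing an endomorphism *)

Section Spatial.
Variables (n k : nat).
Hypotheses (n2 : (1 < n)%N) (k5 : (4 < k)%N).
Variable Phi : autinf n -> autinf n.
Hypotheses (PhiM : {morph Phi : f g / f * g}) (Phisigma : Phi (sigma n) = sigma n).
Local Notation M := (per k).
Implicit Types (x y : fullshift n) (f g : autinf n).

Let k0 : (0 < k)%N. Proof. exact: leq_trans k5. Qed.

Lemma endo_expg f m : Phi (f ^+ m) = Phi f ^+ m.
Proof.
elim: m => [|m IH]; last by rewrite !expgS PhiM IH.
by rewrite !expg0; apply: (mulgI (Phi 1)); rewrite -PhiM !mulg1.
Qed.

Lemma endo_invg f : Phi f^-1 = (Phi f)^-1.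
Proof.
by apply: (mulgI (Phi f)); rewrite -PhiM !mulgV; apply: (endo_expg 1 0).
Qed.

Lemma endo_aut_shift m f : aut_shift m f -> aut_shift m (Phi f).
Proof.
move=> /aut_shiftE fm; apply/aut_shiftE.
by rewrite /commute -Phisigma -endo_expg -!PhiM fm.
Qed.

(** The block gates form a copy of the symmetric group of the words, and Phi
    followed by the action on words is an endomorphism of this group, which
    is inner.  The conjugating permutation is the map p. *)
Lemma exists_point_map :
  (exists s : {perm word n k}, word_perm k (Phi (gate (s * s))) != 1) ->
  exists p p' : fullshift n -> fullshift n,
  [/\ forall x, periodic k x -> periodic k (p x) /\ p' (p x) = x,
      forall x, periodic k x -> periodic k (p' x) /\ p (p' x) = x &
      forall q, blockwise k q -> forall x, periodic k x -> Phi q (p x) = p (q x)].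
Proof.
move=> [s0 s0P]; pose th (s : {perm word n k}) := word_perm k (Phi (gate s)).
have gk (s : {perm word n k}) := endo_aut_shift (gate_aut s).
have thM : {morph th : s t / s * t}.
  by move=> s t; rewrite /th gateM PhiM word_permM.
have T8 : (7 < #|{ffun 'I_k.+1 -> 'I_n}|)%N.
  rewrite card_ffun !card_ord; apply: (@leq_trans (2 ^ k.+1)); last by rewrite leq_exp2r.
  by apply: (@leq_trans (2 ^ 3)) => //; apply: leq_pexp2l => //; lia.
have [pi piP] := perm_endo_inner T8 thM (ex_intro _ s0 s0P).
exists (fun x => periodize (pi (block k x 0))), (fun x => periodize (pi^-1 (block k x 0))).
split=> [x px|x px|q qb x px].
- by split; [exact: periodize_periodic|rewrite block_periodize permK periodize_block].
- by split; [exact: periodize_periodic|rewrite block_periodize permKV periodize_block].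
have := piP (word_perm k q); rewrite /th -blockwise_gate // => E.
have qk : aut_shift k.+1 q by case: qb.
rewrite -word_permE; last exact: endo_aut_shift.
rewrite E permJ; congr (periodize (pi _)).
by apply: periodize_inj; rewrite word_permE // !periodize_block //; apply: aut_periodic.
Qed.

Section PointMap.
Variables (p p' : fullshift n -> fullshift n).
Hypotheses (pP : forall x, periodic k x -> periodic k (p x) /\ p' (p x) = x)
  (p'P : forall x, periodic k x -> periodic k (p' x) /\ p (p' x) = x)
  (p_block : forall q, blockwise k q -> forall x, periodic k x -> Phi q (p x) = p (q x)).

Definition implemented g :=
  aut_shift k.+1 g /\ forall x, periodic k x -> Phi g (p x) = p (g x).

Lemma implementedM f g : implemented f -> implemented g -> implemented (f * g).
Proof.
move=> [fk fp] [gk gp]; split=> [|x px]; first exact: aut_shiftM.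
by rewrite PhiM !autinfM gp // fp //; apply: aut_periodic.
Qed.

Lemma implementedV g : implemented g -> implemented g^-1.
Proof.
move=> [gk gp]; have gVk := aut_shiftV gk; split=> // x px.
apply: (@autinf_inj _ (Phi g)).
by rewrite endo_invg autinfVK gp ?autinfVK //; apply: aut_periodic.
Qed.

Lemma implementedX g m : implemented g -> implemented (g ^+ m).
Proof.
move=> gi; elim: m => [|m IH]; last by rewrite expgS; apply: implementedM.
by rewrite expg0 -(mulgV g); apply: implementedM => //; apply: implementedV.
Qed.

Lemma blockwise_implemented q : blockwise k q -> implemented q.
Proof. by move=> qb; split; [case: qb|apply: p_block]. Qed.

Local Notation pair_gate := (pair_gate k0).

(** A map commuting with the permutations of the two cells a and a + 1 does not
    change these cells: otherwise a transposition fixing the old pair of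
    letters and moving the new one gives a contradiction.  This applies to
    p^-1 Phi(g)^-1 p g, which commutes with every E such that E and g E g^-1 are
    implemented. *)
Lemma implemented_crit g : aut_shift k.+1 g ->
  (forall i : int, exists a : int, (i = a \/ i = a + 1)%R /\
     forall s, implemented (pair_gate a s) /\ implemented (g * pair_gate a s * g^-1)) ->
  implemented g.
Proof.
move=> gk gi; split=> // x px.
pose eps y := p' ((Phi g)^-1 (p (g y))).
have epsE y : periodic k y -> periodic k (eps y) /\ Phi g (p (eps y)) = p (g y).
  move=> py; have pgy : periodic k (p (g y)) by case: (pP (aut_periodic gk py)).
  have [pe E] := p'P (aut_periodic (aut_shiftV (endo_aut_shift gk)) pgy).
  by split=> //; rewrite /eps E autinfVK.
have [pe epsx] := epsE x px.
suff E : eps x = x by rewrite -epsx E.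
apply: funext => i; have [a [ia gia]] := gi i.
set y := eps x.
suff : (y a, y (a + 1)%R) = (x a, x (a + 1)%R) by case=> ? ?; case: ia => ->.
apply/eqP; apply/negPn/negP => ne.
have [c] := @exists_fresh _ [:: (x a, x (a + 1)%R); (y a, y (a + 1)%R)]
  (ltac:(by rewrite card_prod !card_ord /=; nia)).
rewrite !inE negb_or => /andP[cx cy].
pose s := tperm (y a, y (a + 1)%R) c.
have [[_ Ei] [_ gEi]] := gia s; set E := pair_gate a s in Ei gEi.
have Ek : aut_shift k.+1 E by apply: pair_gate_aut.
(* eps commutes with E because g E g^-1 and E are both implemented by p. *)
have epsC : eps (E x) = E y.
  have pEx := aut_periodic Ek px.
  have gE := gEi (g x) (aut_periodic gk px).
  rewrite /y /eps !autinfM autinfK in gE.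
  rewrite /eps -gE !PhiM endo_invg !autinfM autinfK -/(eps x).
  have := Ei _ pe; rewrite -/(eps x) => E2.
  have [_ p'pE] := pP (aut_periodic Ek pe).
  rewrite -p'pE -Ei //; congr (p' (Phi E _)).
  by case: (epsE x px) => _ <-; rewrite autinfK.
have Ex : E x = x.
  rewrite pair_gateE; apply: funext.
  have xmod q r : x (a + q * M + r)%R = x (a + r)%R.
    by rewrite -[in RHS](periodicX q px) /translate; congr (x _); lia.
  have xmod0 q : x (a + q * M)%R = x a by rewrite -[in RHS](periodicX q px).
  have sx : s (x a, x (a + 1)%R) = (x a, x (a + 1)%R) by rewrite tpermD // eq_sym.
  apply: (@pair_cases _ k0 _ a) => [q|q|q r rM].
  - by rewrite (pair_fun_left k0) xmod xmod0 sx.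
  - by rewrite (pair_fun_right k0) xmod xmod0 sx.
  - by rewrite (pair_fun_out k0).
have Ey : E y = y by rewrite -epsC Ex.
have sy : s (y a, y (a + 1)%R) = (y a, y (a + 1)%R).
  have := @pair_fun_left n k k0 a s y 0; have := @pair_fun_right n k k0 a s y 0.
  rewrite -!(pair_gateE k0) -/E Ey mul0r addr0 => Er El.
  by rewrite [LHS]surjective_pairing -El -Er.
by move: cy; rewrite -sy tpermL eqxx.
Qed.

Lemma sigmaX_aut m h : aut_shift m (sigma n ^+ h).
Proof. by apply/aut_shiftE; rewrite /commute -!expgnDr addnC. Qed.

Lemma pair_gate_inner q r s : (0 <= r < M - 1)%R -> implemented (pair_gate (r + q * M)%R s).
Proof.
by move=> rM; rewrite pair_gate_mod; apply/blockwise_implemented/pair_gate_blockwise.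
Qed.

(** Translating by h moves the boundary of the blocks, and each cell belongs
    to a pair that straddles neither the old nor the new boundary, unless
    these boundaries enclose a single cell. *)
Lemma sigmaX_implemented h : (1 < h)%N -> (h < k)%N -> implemented (sigma n ^+ h).
Proof.
move=> h1 hk; apply: implemented_crit => [|i]; first exact: sigmaX_aut.
have conjE a s : sigma n ^+ h * pair_gate a s * (sigma n ^+ h)^-1 =
    pair_gate (a - Posz h)%R s by rewrite pair_gate_conj mulgK.
have [q [r [iE rM]]] := @modz_decomp k i.
have inner a q' r' s : a = (r' + q' * M)%R -> (0 <= r' < M - 1)%R ->
  implemented (pair_gate a s) by move=> ->; apply: pair_gate_inner.
have MS : (M = Posz k + 1)%R by rewrite /per; lia.
have [rbad|rgood] := boolP ((r == M - 1) || (r == Posz h - 1))%R.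
  exists (i - 1)%R; split=> [|s]; first by lia.
  rewrite conjE; split; first by apply: (inner _ q (r - 1)%R); lia.
  have [rE|rE] := eqVneq r (M - 1)%R.
    by apply: (inner _ q (r - 1 - Posz h)%R); lia.
  by apply: (inner _ (q - 1)%R (M - 2)%R); nia.
exists i; split=> [|s]; first by left.
rewrite conjE; split; first by apply: (inner _ q r); lia.
have [rh|rh] := boolP (Posz h <= r)%R; first by apply: (inner _ q (r - Posz h)%R); lia.
by apply: (inner _ (q - 1)%R (r - Posz h + M)%R); nia.
Qed.

(** A translation by one cell is outside the range of [sigmaX_implemented]. *)
Lemma sigma_implemented : implemented (sigma n).
Proof.
have -> : sigma n = sigma n ^+ 3 * (sigma n ^+ 2)^-1.
  by rewrite (expgS _ 2) mulgK.
by apply: implementedM; [|apply: implementedV]; apply: sigmaX_implemented; lia.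
Qed.

Lemma implemented_conj h g : implemented (sigma n ^+ h * g * (sigma n ^+ h)^-1) ->
    implemented g.
Proof.
set S := sigma n ^+ h => gi.
have Si : implemented S by apply/implementedX/sigma_implemented.
have -> : g = S^-1 * (S * g * S^-1) * S by rewrite !mulgA mulVg mul1g mulgKV.
by do 2!apply: implementedM => //; apply: implementedV.
Qed.

Lemma pair_gate_implemented a s : implemented (pair_gate a s).
Proof.
have [q [r [aE rM]]] := @modz_decomp k a.
have [rE|rE] := eqVneq r (M - 1)%R; last first.
  by rewrite aE addrC; apply: pair_gate_inner; lia.
apply: (@implemented_conj 1); rewrite pair_gate_conj mulgK aE.
have -> : (q * M + r - Posz 1 = M - 2 + q * M)%R by lia.
by apply: pair_gate_inner; rewrite /per; lia.
Qed.

(** Conjugation spreads a permutation of two cells by at most r on each side,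
    and what happens there depends on cells at distance at most 3 r from the
    pair, which all lie in one block. *)
Lemma conj_pair_gate_blockwise r g s :
  aut_shift k.+1 g -> has_radius r g -> has_radius r g^-1%g -> (6 * r + 2 <= k.+1)%N ->
  blockwise k (g * pair_gate (3 * Posz r)%R s * g^-1).
Proof.
move=> gk gr gVr rk; split=> [|x y].
  by do 2?apply: aut_shiftM => //; [apply: pair_gate_aut|apply: aut_shiftV].
rewrite !(eq_block0 k0) => xy i iM; rewrite !autinfM !pair_gateE.
have MS : (M = Posz k + 1)%R by rewrite /per; lia.
set a := (3 * Posz r)%R.
have gV j : (Posz r <= j < M - Posz r)%R -> (g^-1 : autinf n) x j = (g^-1 : autinf n) y j.
  by move=> jM; apply: gVr => l lj; apply: xy; lia.
have phase0 (z : fullshift n) j : (- a <= j < M + a)%R ->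
    pair_fun k a s z j = if j == a then (s (z j, z (j + 1)%R)).1
       else if j == (a + 1)%R then (s (z (j - 1)%R, z j)).2 else z j.
  move=> jM; rewrite /pair_fun.
  have [q [t [jE tM]]] := @modz_decomp k (j - a)%R; rewrite jE modz_rem //.
  have q1 : (-1 <= q < 1)%R by apply/andP; split; nia.
  have q2 : (q = 0 \/ q = -1)%R by lia.
  have -> : (t == 0%R) = (j == a) by case: q2 => qE; subst q; apply/eqP/eqP; lia.
  by have -> : (t == 1%R) = (j == a + 1)%R by case: q2 => qE; subst q; apply/eqP/eqP; lia.
have [far|near] := boolP ((i + Posz r < a) || (a + 1 < i - Posz r))%R.
  have out z : g (pair_fun k a s z) i = g z i.
    apply: gr => j jr; rewrite phase0; last by lia.
    by case: eqP => [|_]; [lia|case: eqP => // ?; lia].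
  by rewrite !out !autinfVK xy.
apply: gr => j jr; rewrite !phase0; try by lia.
case: eqP => [ja|_]; first by rewrite !gV //; lia.
by case: eqP => [ja|_]; rewrite !gV //; lia.
Qed.

Lemma has_radius_conj r h g : has_radius r g ->
    has_radius r (sigma n ^+ h * g * (sigma n ^+ h)^-1)%g.
Proof.
move=> gr i x y xy; rewrite !autinfM !sigmaXE; apply: gr => j jr.
by rewrite !sigmaXVE; apply: xy; lia.
Qed.

Lemma radius_implemented r g :
  aut_shift k.+1 g -> has_radius r g -> has_radius r g^-1%g -> (6 * r + 2 <= k.+1)%N ->
  implemented g.
Proof.
move=> gk gr gVr rk; apply: implemented_crit => // i.
exists i; split=> [|s]; first by left.
split; first exact: pair_gate_implemented.
have [q [t [iE tM]]] := @modz_decomp k (i - 3 * Posz r)%R.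
pose h := absz t; have hE : Posz h = t by rewrite /h; lia.
apply: (@implemented_conj h); set S := sigma n ^+ h.
pose g' := S * g * S^-1.
have -> : S * (g * pair_gate i s * g^-1) * S^-1 = g' * pair_gate (3 * Posz r)%R s * g'^-1.
  have <- : S * pair_gate i s * S^-1 = pair_gate (3 * Posz r)%R s.
    rewrite pair_gate_conj mulgK hE -(pair_gate_mod k0 (3 * Posz r)%R s q).
    by congr (pair_gate _ s); lia.
  by rewrite /g' !invgM invgK !mulgA !mulgKV.
apply: blockwise_implemented; apply: conj_pair_gate_blockwise => //.
- apply: aut_shiftM; last exact/aut_shiftV/sigmaX_aut.
  by apply: aut_shiftM => //; apply: sigmaX_aut.
- exact: has_radius_conj.
have -> : (g'^-1 = S * g^-1 * S^-1)%g by rewrite /g' !invgM invgK mulgA.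
exact: has_radius_conj.
Qed.

End PointMap.

Lemma spatial_implementation :
  (exists s : {perm word n k}, word_perm k (Phi (gate (s * s))) != 1) ->
  exists p p' : fullshift n -> fullshift n,
  [/\ forall x, periodic k x -> periodic k (p x) /\ p' (p x) = x,
      forall x, periodic k x -> periodic k (p' x) /\ p (p' x) = x &
      forall g r, aut_shift k.+1 g -> has_radius r g -> has_radius r g^-1%g ->
        (6 * r + 2 <= k.+1)%N -> forall x, periodic k x -> Phi g (p x) = p (g x)].
Proof.
move=> /exists_point_map[p [p' [pP p'P pb]]]; exists p, p'; split=> // g r gk gr gVr rk.
by case: (radius_implemented pP p'P pb gk gr gVr rk).
Qed.

End Spatial.

(** * Maps commuting with the operations on three tracks *)

Section Tracks.
Variable A : finType.
Variables zero one : A.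
Variable m : nat.
Local Notation config := ('I_3 -> int -> A).
Local Notation letter := {ffun 'I_3 -> A}.
Implicit Types (x y : config) (r t : 'I_3) (q : int) (o : 'I_3 -> int) (w : letter).

Definition track0 : 'I_3 := @Ordinal 3 0 isT.
Definition track1 : 'I_3 := @Ordinal 3 1 isT.
Definition track2 : 'I_3 := @Ordinal 3 2 isT.

Lemma trackP r : [\/ r = track0, r = track1 | r = track2].
Proof.
by case: r => [[|[|[|//]]] h]; [apply: Or31|apply: Or32|apply: Or33]; apply: val_inj.
Qed.

Definition slide o x : config := fun r q => x r (q + o r)%R.
Definition letter_map (f : letter -> letter) x : config :=
  fun r q => f [ffun r' => x r' q] r.
Definition track_periodic x := forall r q, x r (q + Posz m)%R = x r q.
Definition slide_all (a : int) := slide (fun=> a).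

Lemma config_eq x y : (forall r q, x r q = y r q) -> x = y.
Proof. by move=> xy; apply: funext => r; apply: funext. Qed.

Lemma track_periodicE x r q q' : track_periodic x -> (q %% Posz m = q' %% Posz m)%Z ->
    x r q = x r q'.
Proof.
move=> px; have aux (j : nat) z : x r (z + (Posz j * Posz m))%R = x r z.
  elim: j => [|j IH]; first by rewrite mul0r addr0.
  by rewrite (_ : (_ + _)%R = (z + Posz j * Posz m + Posz m)%R) ?px //; lia.
have aux2 z : x r z = x r (z %% Posz m)%Z.
  rewrite {1}(divz_eq z (Posz m)) addrC; case: (z %/ Posz m)%Z => j; first exact: aux.
  by rewrite -[LHS](aux j.+1); congr (x r _); lia.
by move=> E; rewrite aux2 E -aux2.
Qed.

Lemma slide_periodic o x : track_periodic x -> track_periodic (slide o x).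
Proof. by move=> px r q; rewrite /slide -[RHS]px; congr (x r _); lia. Qed.

Lemma letter_map_periodic f x : track_periodic x -> track_periodic (letter_map f x).
Proof.
by move=> px r q; rewrite /letter_map; congr (f _ _); apply/ffunP => r'; rewrite !ffunE px.
Qed.

Hypotheses (one0 : one != zero) (m0 : (0 < m)%N).
Variable p : config -> config.
Hypotheses (pper : forall x, track_periodic x -> track_periodic (p x))
  (pinj : forall x y, track_periodic x -> track_periodic y -> p x = p y -> x = y)
  (p_slide : forall o x, track_periodic x -> p (slide o x) = slide o (p x))
  (p_letter : forall (s : {perm letter}) x, track_periodic x ->
     p (letter_map s x) = letter_map s (p x)).

(** A controlled operation: at each q the letters at the offsets o are read,
    and if they satisfy c, the permutation s acts on the one of track t.  When
    c ignores track t this is a conjugate by a slide of a permutation of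
    letters, hence commutes with p. *)
Definition control o t (c : letter -> bool) (s : {perm A}) x : config :=
  fun r q => if (r == t) && c [ffun r' => x r' (q - o t + o r')%R] then
      s (x r q) else x r q.

Definition blind t (c : letter -> bool) :=
  forall w w', (forall r, r != t -> w r = w' r) -> c w = c w'.

Definition control_letter t (c : letter -> bool) (s : {perm A}) w : letter :=
  if c w then [ffun r => if r == t then s (w r) else w r] else w.

Lemma control_letter_inj t c s : blind t c -> injective (control_letter t c s).
Proof.
move=> cb; have cE w : c (control_letter t c s w) = c w.
  rewrite /control_letter; case: ifP => // cw; rewrite -{}cw; apply: cb => r rt.
  by rewrite ffunE (negPf rt).
move=> w w' E; have := cE w; rewrite E cE => cww.
move: E; rewrite /control_letter cww; case: ifP => // _ /ffunP E; apply/ffunP => r.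
by have := E r; rewrite !ffunE; case: ifP => // _ /perm_inj.
Qed.

Lemma control_slide o t c s x :
  control o t c s x = slide (fun r => - o r)%R (letter_map (control_letter t c s)
      (slide o x)).
Proof.
apply: config_eq => r q; rewrite /control /slide /letter_map /control_letter.
have [->|rt] := eqVneq r t => /=.
  case: ifP => _; rewrite !ffunE ?eqxx ?subrK //; by congr (s (x _ _)); lia.
by case: ifP => _; rewrite !ffunE ?(negPf rt) subrK.
Qed.

Lemma control_periodic o t c s x : track_periodic x -> track_periodic (control o t c s x).
Proof.
by move=> px; rewrite control_slide;
    apply/slide_periodic/letter_map_periodic/slide_periodic.
Qed.

Lemma p_control o t c s x : blind t c -> track_periodic x ->
  p (control o t c s x) = control o t c s (p x).
Proof.
move=> cb px; have E : letter_map (control_letter t c s) =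
    letter_map (perm (@control_letter_inj t c s cb)).
  by apply: funext => y; apply: config_eq => r q; rewrite /letter_map permE.
rewrite !control_slide E p_slide; last exact/letter_map_periodic/slide_periodic.
by rewrite p_letter ?p_slide //; apply: slide_periodic.
Qed.

Lemma control_inj o t c s : blind t c -> injective (control o t c s).
Proof.
move=> cb x y E.
have cE z q : c [ffun r' => control o t c s z r' (q + o r')%R] =
    c [ffun r' => z r' (q + o r')%R].
  by apply: cb => r rt; rewrite !ffunE /control (negPf rt).
apply: config_eq => r q.
have cxy : c [ffun r' => x r' (q - o t + o r')%R] = c [ffun r' => y r' (q - o t + o r')%R].
  by rewrite -cE E cE.
have := congr1 (fun z => z r q) E; rewrite /control; have [->|//] := eqVneq r t => /=.
by rewrite cxy; case: ifP => // _ /perm_inj.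
Qed.

(** The property to be transported; the operations that commute with p reflect
    it, so it is enough to reach a point where it is known. *)
Definition slides (a : int) x := p x = slide_all a x.

Lemma slide_all_control a o t c s x :
  slide_all a (control o t c s x) = control o t c s (slide_all a x).
Proof.
apply: config_eq => r q; rewrite /slide_all /slide /control.
have -> //: [ffun r' => x r' (q + a - o t + o r')%R] =
    [ffun r' => x r' (q - o t + o r' + a)%R].
by apply/ffunP => r'; rewrite !ffunE; congr (x _ _); lia.
Qed.

Lemma slides_controlR a o t c s x : blind t c -> track_periodic x ->
  slides a (control o t c s x) -> slides a x.
Proof.
move=> cb px; rewrite /slides p_control // slide_all_control; exact: control_inj.
Qed.

Lemma slides_letter a (s : {perm letter}) x : track_periodic x ->
  slides a (letter_map s x) -> slides a x.
Proof.
move=> px; rewrite /slides p_letter //.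
have -> : slide_all a (letter_map s x) = letter_map s (slide_all a x) by [].
move=> E; apply: config_eq => r q.
have /perm_inj/ffunP/(_ r) : s [ffun r' => p x r' q] = s [ffun r' => slide_all a x r' q].
  by apply/ffunP => r'; have := congr1 (fun z => z r' q) E.
by rewrite !ffunE.
Qed.

Lemma slides_slide a b x : track_periodic x -> slides a (slide_all b x) <-> slides a x.
Proof.
move=> px; rewrite /slides p_slide //.
have -> : slide_all a (slide_all b x) = slide_all b (slide_all a x).
  by apply: config_eq => r q; rewrite /slide_all /slide; congr (x _ _); lia.
split=> [E|-> //]; apply: config_eq => r q.
by have := congr1 (fun z => z r (q - b)%R) E; rewrite /slide_all /slide subrK.
Qed.

(** If the control holds at one place only modulo the period, varying the
    offset of track t rewrites its cells one after the other.  In the proof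
    h j has the first j cells already rewritten. *)
Lemma slides_set_track a o t c q0 x y : blind t c -> track_periodic x -> track_periodic y ->
  (forall q, c [ffun r' => x r' (q + o r')%R] <-> (q %% Posz m = q0 %% Posz m)%Z) ->
  (forall r, r != t -> x r = y r) -> slides a y -> slides a x.
Proof.
move=> cb px py cq xy Gy.
pose h (j : nat) : config :=
  fun r q => if (r == t) && (((q - q0)%R %% Posz m)%Z < Posz j)%R then y r q else x r q.
have hper j : track_periodic (h j).
  move=> r q; rewrite /h px py.
  by rewrite (_ : (q + Posz m - q0 = (q - q0) + Posz m)%R) ?modzDr //; lia.
have h0 : h 0%N = x.
  apply: config_eq => r q; rewrite /h; case: andP => // -[_]; lia.
have hm : h m = y.
  apply: config_eq => r q; rewrite /h; have [->|rt] := eqVneq r t; last by rewrite xy.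
  by rewrite ltz_pmod //=; lia.
suff H j : (j <= m)%N -> slides a (h j) -> slides a x by apply: (H m); rewrite ?hm.
elim: j => [|j IH] jm; first by rewrite h0.
move=> Gj; apply: IH; first exact: ltnW.
pose o' r := if r == t then Posz j else o r.
pose s := tperm (x t (q0 + Posz j)%R) (y t (q0 + Posz j)%R).
apply: (@slides_controlR a o' t c s) => //.
suff -> : control o' t c s (h j) = h j.+1 by [].
apply: config_eq => r q; rewrite /control.
have [->|rt] := eqVneq r t => /=; last by rewrite /h (negPf rt).
have -> : c [ffun r' => h j r' (q - o' t + o' r')%R] =
    c [ffun r' => x r' (q - Posz j + o r')%R].
  by apply: cb => r' rt'; rewrite !ffunE /h /o' eqxx (negPf rt').
have modq : (((q - Posz j)%R %% Posz m)%Z = (q0 %% Posz m)%Z) <->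
    ((q - q0)%R %% Posz m)%Z = Posz j.
  have jE : (Posz j %% Posz m = Posz j)%Z by rewrite modz_small //; lia.
  split=> [/eqP|E].
    rewrite eqz_mod_dvd => d; rewrite -[RHS]jE; apply/eqP; rewrite eqz_mod_dvd.
    by rewrite (_ : (_ - _)%R = (q - Posz j - q0)%R) //; lia.
  apply/eqP; rewrite eqz_mod_dvd (_ : (_ - _)%R = (q - q0 - Posz j)%R); last by lia.
  by rewrite -eqz_mod_dvd E jE.
case: ifP => [/cq/modq E|ncq].
  have qE : (q %% Posz m = (q0 + Posz j)%R %% Posz m)%Z.
    apply/eqP; rewrite eqz_mod_dvd (_ : (_ - _)%R = (q - q0 - Posz j)%R); last by lia.
    by rewrite -eqz_mod_dvd E modz_small //; lia.
  rewrite /h eqxx E /= ltxx (_ : (Posz j < Posz j.+1)%R); last by lia.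
  by rewrite (track_periodicE t px qE) tpermL (track_periodicE t py qE).
have ne : ((q - q0)%R %% Posz m)%Z <> Posz j by move/modq/cq; rewrite ncq.
rewrite /h eqxx /=.
suff -> : (((q - q0)%R %% Posz m)%Z < Posz j.+1)%R =
    (((q - q0)%R %% Posz m)%Z < Posz j)%R by [].
by lia.
Qed.

Definition marker (i : int) : config :=
  fun r q => if (r == track2) && (q %% Posz m == i %% Posz m)%Z then one else zero.
Definition null_letter : letter := [ffun=> zero].
Definition unit_letter t : letter := [ffun r => if r == t then one else zero].

Lemma marker_periodic i : track_periodic (marker i).
Proof. by move=> r q; rewrite /marker modzDr. Qed.

Lemma slide_marker i j : slide_all j (marker i) = marker (i - j)%R.
Proof.
apply: config_eq => r q; rewrite /slide_all /slide /marker.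
by rewrite !eqz_mod_dvd (_ : (q + j - i = q - (i - j))%R) //; lia.
Qed.

Lemma card_letter : (7 < #|{ffun 'I_3 -> A}|)%N.
Proof.
rewrite card_ffun card_ord.
have A2 : (1 < #|A|)%N.
  by rewrite (cardD1 zero) (cardD1 one) !inE one0.
by apply: (@leq_trans (2 ^ 3)) => //; rewrite leq_exp2r.
Qed.

Lemma letter_eq w w' : w track0 = w' track0 -> w track1 = w' track1 -> w track2 =
    w' track2 -> w = w'.
Proof. by move=> E0 E1 E2; apply/ffunP => r; case: (trackP r) => ->. Qed.

(** The permutations of letters fixing the marked and the null letter show
    that the image of the marked point has only these letters.  If it had two
    marks, copying track 2 to track 0 and then looking for a pair of marks at
    their distance would change it, while it does not change the marked
    point. *)
Lemma p_marker : exists a, slides a (marker 0).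
Proof.
set x := marker 0; have px : track_periodic x by apply: marker_periodic.
set y := p x.
have py : track_periodic y by apply: pper.
have xcol q : [ffun r => x r q] = null_letter \/ [ffun r => x r q] = unit_letter track2.
  have [E|E] := boolP (q %% Posz m == 0%R %% Posz m)%Z; [right|left];
  by apply: letter_eq; rewrite !ffunE /x /marker ?E ?(negPf E).
have ycol q : [ffun r => y r q] = null_letter \/ [ffun r => y r q] = unit_letter track2.
  set d := [ffun r => y r q].
  have [->|d0] := eqVneq d null_letter; first by left.
  have [->|d2] := eqVneq d (unit_letter track2); first by right.
  have [d'] := @exists_fresh _ [:: null_letter; unit_letter track2;
      d] (leq_trans (isT : 3 < 8)%N card_letter).
  rewrite !inE !negb_or => /and3P[d'0 d'2 d'd].
  have xfix : letter_map (tperm d d') x = x.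
    apply: config_eq => r z; rewrite /letter_map tpermD ?ffunE //.
      by case: (xcol z) => ->.
    by case: (xcol z) => ->.
  have /(congr1 (fun z => [ffun r => z r q])) := p_letter (tperm d d') px.
  rewrite xfix -/y.
  have -> : [ffun r => letter_map (tperm d d') y r q] = d'.
    by apply/ffunP => r; rewrite ffunE /letter_map tpermL.
  by move=> E; case/eqP: d'd; rewrite -E.
have [q1 yq1] : exists q, [ffun r => y r q] = unit_letter track2.
  apply/not_existsP => ynone.
  have y0 q : [ffun r => y r q] = null_letter by case: (ycol q) => // /ynone.
  have ne12 : unit_letter track2 != unit_letter track1.
    by apply/eqP => /ffunP/(_ track1); rewrite !ffunE /= => /eqP;
        rewrite eq_sym (negPf one0).
  have neq0 t : unit_letter t != null_letter.
    by apply/eqP => /ffunP/(_ t); rewrite !ffunE eqxx => /eqP; rewrite (negPf one0).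
  have yfix : letter_map (tperm (unit_letter track2) (unit_letter track1)) y = y.
    apply: config_eq => r q; rewrite /letter_map y0 tpermD //.
    by rewrite -(y0 q) ffunE.
  have := p_letter (tperm (unit_letter track2) (unit_letter track1)) px; rewrite -/y yfix.
  move=> /pinj E; have /(congr1 (fun z => [ffun r => z r 0%R])) :=
      E (letter_map_periodic _ px) px.
  have x0 : [ffun r => x r 0%R] = unit_letter track2.
    by apply: letter_eq; rewrite !ffunE /x /marker ?eqxx.
  have -> : [ffun r => letter_map (tperm (unit_letter track2) (unit_letter track1)) x r
      0%R] = unit_letter track1.
    by apply/ffunP => r; rewrite ffunE /letter_map x0 tpermL.
  by rewrite x0 => /esym/eqP; rewrite (negPf ne12).
exists (- q1)%R; rewrite /slides slide_marker opprK add0r -/y.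
pose s := tperm zero one.
have yuniq q2 : [ffun r => y r q2] = unit_letter track2 -> (q2 %% Posz m = q1 %% Posz m)%Z.
  move=> yq2; apply/eqP; rewrite eqz_mod_dvd; apply/negPn/negP => nd.
  pose c1 (w : letter) := w track2 != zero.
  pose c2 (w : letter) := (w track2 != zero) && (w track0 != zero).
  have b1 : blind track0 c1 by move=> w w' E; rewrite /c1 E.
  have b2 : blind track1 c2 by move=> w w' E; rewrite /c2 !E.
  (* T copies the marks to track 0, Q looks for two marks at distance q2 - q1. *)
  pose T := control (fun=> 0%R) track0 c1 s.
  pose o r := if r == track0 then (q2 - q1)%R else 0%R.
  pose Q := control o track1 c2 s.
  have pTx : track_periodic (T x) by apply: control_periodic.
  have TE z r q : T z r q = if (r == track0) && (z track2 q != zero) then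
      s (z r q) else z r q.
    by rewrite /T /control /c1 ffunE subr0 addr0.
  have QE z r q : Q z r q = if (r == track1) &&
      ((z track2 q != zero) && (z track0 (q + (q2 - q1))%R != zero))
      then s (z r q) else z r q.
    by rewrite /Q /control /c2 !ffunE /o /= subr0 addr0.
  have QTx : Q (T x) = T x.
    apply: config_eq => r q; rewrite QE; case: ifP => // /and3P[_].
    rewrite !TE /= /x /marker /=; case: ifP => [E1 _|]; last by rewrite eqxx.
    case: ifP => [|]; last by rewrite eqxx.
    case: ifP => [E2 _ _|]; last by rewrite eqxx.
    exfalso; move: E1 E2 nd; rewrite !eqz_mod_dvd !subr0 => d1.
    by rewrite rpredDl // => ->.
  have := p_control o s b2 pTx; rewrite -/(Q _) QTx /T p_control // -/y -/T -/(Q _).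
  move=> /(congr1 (fun z => z track1 q1)).
  have [/ffunP y1 /ffunP y2'] := (yq1, yq2).
  have := (y1 track1, y1 track2, y2' track0, y2' track2);
      rewrite !ffunE /= => -[[[E11 E12] E20] E22].
  rewrite QE !TE /= (_ : (q1 + (q2 - q1) = q2)%R); last by lia.
  rewrite E11 E12 E20 E22 one0 /= /s tpermL one0.
  by move/eqP; rewrite eq_sym (negPf one0).
apply: config_eq => r q; rewrite /marker.
have [E|nE] := eqVneq (q %% Posz m)%Z (q1 %% Posz m)%Z.
  rewrite (track_periodicE r py E); have /ffunP/(_ r) := yq1; rewrite !ffunE => ->.
  by rewrite andbT.
have /ffunP/(_ r) : [ffun r => y r q] = null_letter.
  by case: (ycol q) => // /yuniq E; rewrite E eqxx in nE.
by rewrite !ffunE andbF.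
Qed.

(** The support of track 0 is copied to the part of track 1 that is known to
    be empty.  Comparing track 0 with its copy at the distance j of its
    extreme marks singles out the leftmost mark, from which track 2, then
    tracks 0 and 1, can be rewritten. *)
Lemma slides_sparse0 a x (K : nat) : slides a (marker 0) -> track_periodic x ->
    (4 * K <= m)%N ->
  (forall r q, x r q != zero -> ((q %% Posz m)%Z < Posz K)%R) ->
  (exists q, x track0 q != zero) -> slides a x.
Proof.
move=> G0 px K4 xK [q0 xq0].
have sumK b d : (b < K)%N -> (d < K)%N -> (b + d < m)%N /\ (K <= b + (2 * K + d) < m)%N.
  by lia.
have modm z : (0 <= (z %% Posz m)%Z < Posz m)%R by rewrite modz_ge0 ?ltz_pmod //=; lia.
have xmod r z : x r z = x r (z %% Posz m)%Z by apply: track_periodicE; rewrite // modz_mod.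
pose P (i : nat) := (i < K)%N && (x track0 (Posz i) != zero).
have Pex : exists i, P i.
  exists (absz (q0 %% Posz m)%Z); have := modm q0; have := xK _ _ xq0 => h1 h2.
  have E : Posz (absz (q0 %% Posz m)%Z) = (q0 %% Posz m)%Z by lia.
  by rewrite /P E -xmod xq0 andbT -ltz_nat E.
have Pb i : P i -> (i <= K)%N by case/andP => /ltnW.
case: (ex_minnP Pex) => i0 Pi0 i0min; case: (ex_maxnP Pex Pb) => i1 Pi1 i1max.
have i01 := i0min _ Pi1; pose j := (i1 - i0)%N.
have [i0K xi0] := andP Pi0; have [i1K xi1] := andP Pi1.
pose s := tperm zero one.
(* A copy of the support of track 0, far away on track 1. *)
pose c1 (w : letter) := w track0 != zero.
have b1 : blind track1 c1 by move=> w w' E; rewrite /c1 E.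
pose o1 r := if r == track1 then Posz (2 * K) else 0%R.
pose x2 := control o1 track1 c1 s x.
have px2 : track_periodic x2 by apply: control_periodic.
apply: (@slides_controlR a o1 track1 c1 s) => //; rewrite -/x2.
have x2E r q : x2 r q = if (r == track1) && (x track0 (q - Posz (2 * K))%R != zero) then
    s (x r q) else x r q.
  by rewrite /x2 /control /c1 ffunE /o1 /= addr0.
pose i0z := Posz i0.
(* The first and the last position of the support are recognized by their distance. *)
pose c2 (w : letter) := (w track0 != zero) && (w track1 != zero).
have b2 : blind track2 c2 by move=> w w' E; rewrite /c2 !E.
pose o2 r := if r == track1 then Posz (2 * K + j) else 0%R.
pose x3 : config := fun r => if r == track2 then marker i0z track2 else x2 r.
have px3 : track_periodic x3.
  by move=> r q; rewrite /x3; case: ifP => _; [apply: marker_periodic|apply: px2].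
have cq2 q : c2 [ffun r' => x2 r' (q + o2 r')%R] <-> (q %% Posz m = i0z %% Posz m)%Z.
  rewrite /c2 !ffunE /o2 /= addr0 !x2E /=.
  have -> : (q + Posz (2 * K + j) - Posz (2 * K) = q + Posz j)%R by lia.
  rewrite (_ : (i0z %% Posz m)%Z = i0z); last by rewrite modz_small // /i0z; lia.
  split=> [/andP[xq x1q]|E].
    have [i iE] : exists i : nat, (q %% Posz m)%Z = Posz i.
      by exists (absz (q %% Posz m)%Z); have := modm q; lia.
    have iK : (i < K)%N by have := xK _ _ xq; rewrite iE.
    have qE l : (i + l < m)%N -> ((q + Posz l)%R %% Posz m)%Z = Posz (i + l).
      by move=> il; rewrite -modzDml iE modz_small.
    have Pi : P i by rewrite /P iK -iE -xmod.
    have ij : P (i + j)%N.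
      have jK : (j < K)%N by rewrite /j ltn_subLR // (leq_trans i1K) // leq_addl.
      move: x1q; case: ifP => [xj _|_ x1q].
        have [ijm _] := sumK i j iK jK.
        have := xK _ _ xj; rewrite /P qE // ltz_nat => -> /=.
        by rewrite -qE // -xmod.
      have [_ /andP[Ki im]] := sumK i j iK jK.
      by have := xK _ _ x1q; rewrite qE // ltz_nat ltnNge Ki.
    rewrite iE /i0z; congr Posz; apply/eqP; rewrite eqn_leq i0min // andbT.
    by have := i1max _ ij; rewrite /j addnBA // leq_subLR leq_add2r.
  have qE l : (Posz (i0 + l) < Posz m)%R -> ((q + Posz l)%R %% Posz m)%Z = Posz (i0 + l).
    by move=> il; rewrite -modzDml E modz_small //; rewrite /i0z; lia.
  have xq : x track0 q != zero by rewrite xmod E.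
  have xj : x track0 (q + Posz j)%R != zero.
    by rewrite xmod qE ?subnKC //; rewrite /j; lia.
  rewrite xq xj /=.
  have -> : x track1 (q + Posz (2 * K + j))%R = zero.
    have jK : (j < K)%N by rewrite /j ltn_subLR // (leq_trans i1K) // leq_addl.
    have [_ /andP[Ki im]] := sumK i0 j i0K jK.
    by apply/eqP/negPn/negP => /xK; rewrite qE // ltz_nat ltnNge Ki.
  by rewrite /s tpermL one0.
apply: (slides_set_track b2 px2 px3 cq2) => [r rt|]; first by rewrite /x3 (negPf rt).
have x3E : x3 track2 = marker i0z track2 by rewrite /x3.
pose c3 (w : letter) := w track2 != zero.
have c3P q : (marker i0z track2 q != zero) <-> (q %% Posz m = i0z %% Posz m)%Z.
  rewrite /marker /=; case: ifP => [/eqP ->|/eqP ne]; first by rewrite one0.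
  by rewrite eqxx.
pose x4 : config := fun r => if r == track0 then (fun=> zero) else x3 r.
have px4 : track_periodic x4.
  by move=> r q; rewrite /x4; case: ifP => // _; apply: px3.
have b3 t : t != track2 -> blind t c3.
  by move=> t2t w w' E; rewrite /c3 E // eq_sym.
have cq3 q : c3 [ffun r' => x3 r' (q + 0)%R] <-> (q %% Posz m = i0z %% Posz m)%Z.
  by rewrite /c3 ffunE addr0 x3E; apply: c3P.
apply: (slides_set_track (o := fun=> 0%R) (b3 track0 isT) px3 px4 cq3) => [r rt|].
  by rewrite /x4 (negPf rt).
have cq4 q : c3 [ffun r' => x4 r' (q + 0)%R] <-> (q %% Posz m = i0z %% Posz m)%Z.
  by rewrite /c3 ffunE addr0 /x4 /= x3E; apply: c3P.
apply: (slides_set_track (o :=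
    fun=> 0%R) (b3 track1 isT) px4 (marker_periodic i0z) cq4) => [r rt|].
  by rewrite /x4 /x3 /marker; case: (trackP r) rt => ->.
rewrite -(slides_slide a i0z (marker_periodic _)) slide_marker subrr.
exact: G0.
Qed.

(** A translation moves the support next to the origin, and a permutation of
    letters fixing the null letter puts a mark on track 0. *)
Lemma slides_sparse a x (K : nat) (c : int) :
  slides a (marker 0) -> track_periodic x -> (4 * K <= m)%N ->
  (forall r q, x r q != zero -> (((q - c)%R %% Posz m)%Z < Posz K)%R) ->
  (exists r q, x r q != zero) -> slides a x.
Proof.
move=> G0 px K4 xK [r [q xrq]].
rewrite -(slides_slide a c px); set x' := slide_all c x.
have px' : track_periodic x' by apply: slide_periodic.
pose q' := (q - c)%R; pose d := [ffun r' => x' r' q'].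
have d0 : d != null_letter.
  apply/eqP => /ffunP/(_ r); rewrite !ffunE /x' /slide_all /slide /q' subrK => E.
  by rewrite E eqxx in xrq.
have u0 : unit_letter track0 != null_letter.
  by apply/eqP => /ffunP/(_ track0); rewrite !ffunE eqxx => /eqP; rewrite (negPf one0).
apply: (@slides_letter a (tperm d (unit_letter track0))) => //.
apply: (@slides_sparse0 a _ K) => //; first exact: letter_map_periodic.
  move=> r' z; apply: contraNT => zK.
  have x0 : [ffun r'' => x' r'' z] = null_letter.
    apply/ffunP => r''; rewrite !ffunE; apply/eqP/negPn/negP => /xK.
    by rewrite addrK (negPf zK).
  by rewrite /letter_map x0 tpermD // ffunE.
exists q'; rewrite /letter_map -/d tpermL ffunE /=; exact: one0.
Qed.

End Tracks.

(** * Tracks of a point of the full shift *)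

Section Generators.
Variable n : nat.
Local Notation config := ('I_3 -> int -> 'I_n).
Implicit Types (x y : fullshift n) (c : config) (r t : 'I_3) (o : 'I_3 -> int).

Definition tracks x : config := fun r q => x (q * per 2 + Posz r)%R.
Definition untracks c : fullshift n := fun i => c (phase 2 i) (i %/ per 2)%Z.

Lemma tracksK : cancel tracks untracks.
Proof.
move=> x; apply: funext => i; rewrite /untracks /tracks phaseE.
by congr (x _); rewrite -divz_eq.
Qed.

Lemma untracksK : cancel untracks tracks.
Proof.
by move=> c; apply: config_eq => r q; rewrite /tracks /untracks phase_ord quot_ord.
Qed.

Lemma tracks_gate (s : {perm word n 2}) x :
  tracks (gate s x) = letter_map s (tracks x).
Proof.
apply: config_eq => r q.
by rewrite gateE /tracks /gate_fun quot_ord phase_ord.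
Qed.

Lemma slideD o o' c : slide o (slide o' c) = slide (fun r => o r + o' r)%R c.
Proof. by apply: config_eq => r q; rewrite /slide; congr (c _ _); lia. Qed.

Lemma eq_slide o o' c : o =1 o' -> slide o c = slide o' c.
Proof. by move=> /funext ->. Qed.

Lemma slide0 c : slide (fun=> 0%R) c = c.
Proof. by apply: config_eq => r q; rewrite /slide addr0. Qed.

Lemma tracks_translate a x : tracks (translate (a * per 2)%R x) = slide_all a (tracks x).
Proof.
by apply: config_eq => r q; rewrite /tracks /slide_all /slide /translate; congr (x _); lia.
Qed.

Lemma slide_allC a o c : slide_all a (slide o c) = slide o (slide_all a c).
Proof. by rewrite /slide_all !slideD; apply: eq_slide => r; rewrite addrC. Qed.

Definition unit_offset t : 'I_3 -> int := fun r => if r == t then 1%R else 0%R.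

Lemma slide_radius o : (forall r, (-1 <= o r <= 1)%R) ->
    has_radius 3 (fun x => untracks (slide o (tracks x))).
Proof.
move=> o1 i x y xy; rewrite /untracks /slide /tracks phaseE; apply: xy.
by have := o1 (phase 2 i); rewrite /per; lia.
Qed.

Lemma slider_exists t : exists f : autinf n,
  (forall x, f x = untracks (slide (unit_offset t) (tracks x))) /\ aut_shift 3 f.
Proof.
have o1 r : (-1 <= unit_offset t r <= 1)%R by rewrite /unit_offset; case: ifP.
have o2 r : (-1 <= - unit_offset t r <= 1)%R by rewrite /unit_offset; case: ifP.
apply: (@build_autinf _ _ (fun x => untracks (slide (fun r => - unit_offset t r)%R
    (tracks x)))) => //.
- move=> x; rewrite untracksK slideD -[RHS]tracksK; congr untracks.
  by rewrite -[RHS]slide0; apply: eq_slide => r; rewrite addNr.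
- move=> x; rewrite untracksK slideD -[RHS]tracksK; congr untracks.
  by rewrite -[RHS]slide0; apply: eq_slide => r; rewrite addrN.
- by move=> i; exists 3 => x y; apply: slide_radius.
- by move=> i; exists 3 => x y; apply: slide_radius.
move=> x; apply: (can_inj tracksK).
have E z : translate (Posz 3) z = translate (1 * per 2)%R z by [].
by rewrite !E untracksK !tracks_translate untracksK slide_allC.
Qed.

Definition slider t : autinf n := projT1 (cid (slider_exists t)).

Lemma tracks_slider t x : tracks (slider t x) = slide (unit_offset t) (tracks x).
Proof. by rewrite /slider; case: cid => f [/= -> _]; rewrite untracksK. Qed.

Lemma slider_aut t : aut_shift 3 (slider t).
Proof. by rewrite /slider; case: cid => f []. Qed.

Lemma slider_radius t : has_radius 3 (slider t) /\ has_radius 3 (slider t)^-1%g.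
Proof.
have o1 r : (-1 <= unit_offset t r <= 1)%R by rewrite /unit_offset; case: ifP.
have o2 r : (-1 <= - unit_offset t r <= 1)%R by rewrite /unit_offset; case: ifP.
split=> i x y xy.
  have E z : slider t z = untracks (slide (unit_offset t) (tracks z)).
    by rewrite -tracks_slider tracksK.
  by rewrite !E; apply: (slide_radius o1).
have E z : ((slider t)^-1 : autinf n) z =
    untracks (slide (fun r => - unit_offset t r)%R (tracks z)).
  apply: (@autinf_inj _ (slider t)); apply: (can_inj tracksK).
  rewrite autinfVK tracks_slider untracksK slideD -[LHS]slide0; by apply: eq_slide => r;
      rewrite addrN.
by rewrite !E; apply: (slide_radius o2).
Qed.

Lemma gateV k (s : {perm word n k}) : (gate s)^-1 = gate s^-1.
Proof.
apply: (mulgI (gate s)); rewrite mulgV -gateM mulVg.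
by apply: autinf_eqP => x; rewrite gateE gate_fun1.
Qed.

Lemma gate_radius k (s : {perm word n k}) : has_radius k.+1 (gate s).
Proof.
move=> i x y xy; rewrite !gateE /gate_fun; congr (s _ _); apply/ffunP => r.
rewrite !ffunE; apply: xy; have := ltn_ord r; have := divz_eq i (per k).
have : (0 <= (i %% per k)%Z < per k)%R by rewrite modz_ge0 ?ltz_pmod.
by rewrite /per; lia.
Qed.

Section Sparse.
Variables (z0 z1 : 'I_n) (m k : nat).
Hypotheses (z10 : z1 != z0) (m0 : (0 < m)%N) (kE : k.+1 = (m * 3)%N).
Variables p p' : fullshift n -> fullshift n.
Hypotheses (pP : forall x, periodic k x -> periodic k (p x) /\ p' (p x) = x)
  (p_gate : forall (s : {perm word n 2}) x, periodic k x -> p (gate s x) = gate s (p x))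
  (p_slider : forall t x, periodic k x -> p (slider t x) = slider t (p x)).

Lemma periodic_tracks x : periodic k x <-> track_periodic m (tracks x).
Proof.
have perE : per k = (Posz m * per 2)%R by rewrite /per kE; lia.
split=> [px r q|px].
  rewrite -[in RHS](px) /tracks /translate perE; congr (x _); lia.
apply: (can_inj tracksK); rewrite perE tracks_translate; exact: config_eq.
Qed.

(** Sliders generate all slides; inverses come for free because p commutes with
    a slide at every periodic point. *)
Lemma p_slide_tracks o c : track_periodic m c ->
  tracks (p (untracks (slide o c))) = slide o (tracks (p (untracks c))).
Proof.
pose C o := forall c, track_periodic m c ->
  tracks (p (untracks (slide o c))) = slide o (tracks (p (untracks c))).
have C0 : C (fun=> 0%R) by move=> d _; rewrite !slide0.
have CD o1 o2 : C o1 -> C o2 -> C (fun r => o1 r + o2 r)%R.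
  move=> C1 C2 d pd; rewrite -!slideD C1 ?C2 //; exact: slide_periodic.
have CN o1 : C o1 -> C (fun r => - o1 r)%R.
  move=> C1 d pd; set e := slide _ d.
  have -> : d = slide o1 e.
    by rewrite /e slideD -[LHS]slide0; apply: eq_slide => r; rewrite addrN.
  rewrite C1 /e ?slideD; last exact: slide_periodic.
  rewrite -[LHS]slide0; apply: eq_slide => r; by rewrite addNr.
have CU t : C (unit_offset t).
  move=> d pd; have pu : periodic k (untracks d) by apply/periodic_tracks;
      rewrite untracksK.
  by rewrite -tracks_slider -p_slider // -[in RHS](tracksK (slider t _)) tracks_slider
      untracksK.
have CZ t (a : int) : C (fun r => unit_offset t r * a)%R.
  have Cn (j : nat) : C (fun r => unit_offset t r * Posz j)%R.
    elim: j => [|j IH].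
      by rewrite (_ : (fun r => _) = (fun=> 0%R)) //; apply: funext => r; rewrite mulr0.
    have := CD _ _ (CU t) IH; congr C; apply: funext => r; lia.
  case: a => j; first exact: Cn.
  have := CN _ (Cn j.+1); congr C; apply: funext => r; lia.
have := CD _ _ (CZ track0 (o track0)) (CD _ _ (CZ track1 (o track1)) (CZ track2 (o
    track2))).
rewrite (_ : (fun r => _) = o); first exact.
apply: funext => r; rewrite /unit_offset; case: (trackP r) => -> /=; lia.
Qed.

Lemma point_map_translates : exists a : int, forall x (K : nat) (b : int),
  periodic k x -> (4 * K <= m)%N -> x <> (fun=> z0) ->
  (forall i, x i != z0 -> (((i - b * 3)%R %% per k)%Z < Posz K * 3)%R) ->
  p x = translate (a * 3)%R x.
Proof.
pose pt c := tracks (p (untracks c)).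
have puP c : track_periodic m c -> periodic k (untracks c).
  by move=> pc; apply/periodic_tracks; rewrite untracksK.
have pt_per c : track_periodic m c -> track_periodic m (pt c).
  by move=> /puP pc; apply/periodic_tracks; case: (pP pc).
have pt_inj c c' : track_periodic m c -> track_periodic m c' -> pt c = pt c' -> c = c'.
  move=> /puP pc /puP pc' /(can_inj tracksK) E; apply: (can_inj untracksK).
  by have [_ <-] := pP pc; have [_ <-] := pP pc'; rewrite E.
have pt_letter (s : {perm {ffun 'I_3 -> 'I_n}}) c : track_periodic m c ->
    pt (letter_map s c) = letter_map s (pt c).
  move=> /puP pc; rewrite /pt -[in RHS]tracks_gate -p_gate //.
  by rewrite -[in RHS](tracksK (gate _ _)) tracks_gate untracksK.
have [a aP] := p_marker z10 m0 pt_per pt_inj p_slide_tracks pt_letter.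
exists a => x K b px K4 x0 xK.
have H : slides pt a (tracks x).
  apply: (slides_sparse z10 m0 p_slide_tracks pt_letter (K := K) (c := b) aP) => //.
  - exact/periodic_tracks.
  - move=> r q /xK; have perE : per k = (Posz m * 3)%R by rewrite /per kE; lia.
    rewrite (_ : (q * per 2 + Posz r - b * 3)%R = ((q - b) * 3 + Posz r)%R); last
        by rewrite /per; lia.
    have := divz_eq (q - b)%R (Posz m); set h := ((_ %/ _)%Z); set l := (_ %% _)%Z => E.
    have lm : (0 <= l < Posz m)%R by rewrite modz_ge0 ?ltz_pmod //; lia.
    have r3 := ltn_ord r.
    rewrite E perE (_ : ((_ + _) * 3 + _)%R = (h * (Posz m * 3) + (l * 3 + Posz r))%R);
        last by lia.
    by rewrite modzMDl modz_small; lia.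
  apply/not_existsP => none; apply: x0; apply: (can_inj tracksK).
  apply: config_eq => r q; apply/eqP/negPn/negP => ne; apply: (none r).
  by exists q.
by apply: (can_inj tracksK); move: H; rewrite /slides /pt tracksK -tracks_translate.
Qed.

End Sparse.
End Generators.

(** * Automorphisms fixing the generators *)

Lemma pigeonhole (m : nat) (a : nat -> 'I_m.+1) :
  exists b, forall N, exists j, (N <= j)%N /\ a j = b.
Proof.
apply: contrapT => /forallNP none.
have bounded b : exists N, forall j, (N <= j)%N -> a j <> b.
  have /existsNP[N /forallNP NP] := none b.
  by exists N => j Nj ab; apply: (NP j).
have [N NP] := choice bounded.
by apply: (NP (a (\max_b N b)) _ (leq_bigmax _)).
Qed.

Section Rigid.
Variable n : nat.
Hypothesis n2 : (1 < n)%N.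
Variable Phi : autinf n -> autinf n.
Hypotheses (PhiM : {morph Phi : f g / f * g}) (Phisigma : Phi (sigma n) = sigma n).
Hypothesis Phigate : forall s : {perm word n 2}, Phi (gate s) = gate s.
Hypothesis Phislider : forall t, Phi (slider n t) = slider n t.
Implicit Types (x y : fullshift n) (f g : autinf n).

Let z0 : 'I_n := Ordinal (ltnW n2).
Let z1 : 'I_n := Ordinal n2.
Let z10 : z1 != z0. Proof. by []. Qed.
Definition zero_point : fullshift n := fun=> z0.

(** Blocks of length 3 refine the blocks of any length divisible by 3. *)
Lemma gate3_blockwise k (s : {perm word n 2}) : (3 %| k.+1)%N -> blockwise k (gate s).
Proof.
move=> /dvdnP[m kE]; split; first by rewrite kE mulnC; apply/aut_shift_mull/gate_aut.
move=> x y /ffunP xy; apply/ffunP => r; rewrite !ffunE !gateE /gate_fun.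
congr (s _ _); apply/ffunP => t; rewrite !ffunE mul0r add0r.
have rk : (r < m * 3)%N by rewrite -kE.
have t3 := ltn_ord t.
have hE : (Posz r %/ per 2)%Z = Posz (r %/ 3)%N by rewrite /per; lia.
pose l := (r %/ 3 * 3 + t)%N.
have lk : (l < k.+1)%N by rewrite kE /l; lia.
have := xy (Ordinal lk); rewrite !ffunE mul0r add0r /=.
by rewrite hE (_ : Posz l = ((Posz (r %/ 3)%N) * per 2 + Posz t)%R) // /l /per; lia.
Qed.

(** The square of a 3-cycle of words of length 3 is fixed by Phi and not
    trivial. *)
Lemma Phi_gate_nontrivial k : (3 %| k.+1)%N ->
  exists s : {perm word n k}, word_perm k (Phi (gate (s * s))) != 1.
Proof.
move=> k3; have W7 := @card_letter _ z0 z1 z10.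
have [w1 _] := @exists_fresh _ [::] (leq_trans (isT : 0 < 8)%N W7).
have [w2] := @exists_fresh _ [:: w1] (leq_trans (isT : 1 < 8)%N W7).
rewrite inE => w21.
have [w3] := @exists_fresh _ [:: w1; w2] (leq_trans (isT : 2 < 8)%N W7).
rewrite !inE negb_or => /andP[w31 w32].
pose s : {perm word n 2} := tperm w1 w2 * tperm w1 w3.
have gb t := gate3_blockwise t k3.
exists (word_perm k (gate s)).
rewrite gateM -!blockwise_gate // -gateM Phigate; apply/eqP => E.
have E1 : gate (s * s) = 1.
  rewrite (blockwise_gate (gb (s * s))) E.
  by apply: autinf_eqP => x; rewrite gateE gate_fun1.
have : s * s = 1.
  rewrite -(word_perm_gate (s * s)) E1; apply/permP => w; apply: periodize_inj.
  by rewrite word_permE ?perm1 //; apply/aut_shiftP.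
have sw1 : s w1 = w2 by rewrite permM tpermL tpermD // eq_sym.
have sw2 : s w2 = w3 by rewrite permM tpermR tpermL.
by move/permP/(_ w1); rewrite permM sw1 sw2 perm1 => /eqP; rewrite (negPf w31).
Qed.

Local Notation conjugated b f :=
  (forall x, Phi f (translate (b * 3)%R x) = translate (b * 3)%R (f x)).

(** The integer a such that the point map of period 3 m translates sparse
    points by 3 a, stated without mentioning that map: both x and f x are sparse,
    so Phi f maps the translate of x to the translate of f x. *)
Definition slide_exponent (m : nat) (a : int) :=
  forall f r, aut_shift (3 * m) f -> has_radius r f -> has_radius r f^-1%g ->
    (6 * r + 2 <= 3 * m)%N ->
  forall x (K : nat) (b : int), translate (Posz (3 * m)) x = x -> (4 * K <= m)%N ->
    x <> zero_point -> f x <> zero_point ->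
    (forall i, x i != z0 -> (((i - b * 3)%R %% Posz (3 * m))%Z < Posz K * 3)%R) ->
    (forall i, f x i != z0 -> (((i - b * 3)%R %% Posz (3 * m))%Z < Posz K * 3)%R) ->
    Phi f (translate (a * 3)%R x) = translate (a * 3)%R (f x).

Lemma slide_exponent_exists m : (6 < m)%N -> exists a, slide_exponent m a.
Proof.
move=> m6; pose k := (3 * m).-1; have kE : k.+1 = (3 * m)%N by rewrite /k; lia.
rewrite /slide_exponent -kE; have k5 : (4 < k)%N by lia.
have k3 : (3 %| k.+1)%N by rewrite kE dvdn_mulr.
have [p [p' [pP p'P pI]]] :=
    spatial_implementation n2 k5 PhiM Phisigma (Phi_gate_nontrivial k3).
have pgate (s : {perm word n 2}) x : periodic k x -> p (gate s x) = gate s (p x).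
  move=> px; rewrite -{2}(Phigate s) (@pI _ 3) //; last by lia.
  - by case: (gate3_blockwise s k3).
  - exact: gate_radius.
  - by rewrite gateV; apply: gate_radius.
have pslider t x : periodic k x -> p (slider n t x) = slider n t (p x).
  move=> px; have [r1 r2] := slider_radius n t.
  rewrite -{2}(Phislider t) (@pI _ 3) //; last by lia.
  by rewrite kE; apply/aut_shift_mull/slider_aut.
have kE' : k.+1 = (m * 3)%N by lia.
have m0 : (0 < m)%N by lia.
have [a aP] := point_map_translates z10 m0 kE' pP pgate pslider.
exists a => f r fk fr fVr rk x K b px K4 x0 fx0 xK fxK.
have pfx : periodic k (f x) by apply: aut_periodic.
by rewrite -(aP x K b) // -(aP (f x) K b) // (pI f r).
Qed.

(** The exponents of the periods 3 m j agree modulo m for arbitrarily large j.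
    Given x and a coordinate i, some sparse point y of such a period agrees
    with x on a large window and vanishes elsewhere, except for one mark that
    makes it nonzero; its image under f is again sparse because f fixes the
    zero point. *)
Lemma fix_zero_conjugated m : (0 < m)%N -> exists b : int,
  forall f, aut_shift (3 * m) f -> f zero_point = zero_point -> conjugated b f.
Proof.
move=> m0.
have /choice[a aP] : forall l, exists a, (6 < l)%N -> slide_exponent l a.
  move=> l; have [l6|_] := boolP (6 < l)%N; last by exists 0%R.
  by have [a aP] := slide_exponent_exists l6; exists a.
case: m m0 => // m _.
have [b bP] := pigeonhole (fun j => phase m (a (j * m.+1)%N)).
exists (Posz b) => f fm f0 x; apply: funext => i.
have [r [fr fVr]] := common_radius f; have [R PhiR] := exists_radius (Phi f).
pose V := (absz i + 3 * b + r + R + 1)%N.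
have [j [jN jb]] := bP (20 * V + 20)%N.
pose l := (j * m.+1)%N; have lj : (j <= l)%N by rewrite leq_pmulr.
have [c ac] : exists c : int, a l = (Posz b + c * Posz m.+1)%R.
  exists (a l %/ Posz m.+1)%Z; rewrite -jb phaseE addrC; exact: divz_eq.
pose P := Posz (3 * l).
(* The extra mark at 3 V, just outside the window, makes y nonzero. *)
pose y : fullshift n := fun q => let q' := ((q + 3 * Posz V)%R %% P)%Z in
  if (q' < 6 * Posz V)%R then x (q' - 3 * Posz V)%R
  else if q' == (6 * Posz V)%R then z1 else z0.
have yper : translate P y = y.
  apply: funext => q; rewrite /translate /y.
  by rewrite (_ : (q + P + 3 * Posz V = (q + 3 * Posz V) + P)%R) ?modzDr //; lia.
have yx q : (- (3 * Posz V) <= q < 3 * Posz V)%R -> y q = x q.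
  move=> qV; rewrite /y modz_small; last by rewrite /P; lia.
  by rewrite ifT; [congr (x _); lia|lia].
have ysupp q : y q != z0 -> (((q + 3 * Posz V)%R %% P)%Z <= 6 * Posz V)%R.
  rewrite /y; case: ifP => [|_]; first by lia.
  by case: ifP => [/eqP|_]; [lia|rewrite eqxx].
have support (q e : int) : (- (3 * Posz V) <= e <= 3 * Posz V)%R -> y (q + e)%R != z0 ->
    (((q - (- (2 * Posz V)) * 3)%R %% P)%Z < Posz (4 * V + 1) * 3)%R.
  move=> eV /ysupp; have := divz_eq (q + e + 3 * Posz V)%R P.
  have : (0 <= ((q + e + 3 * Posz V)%R %% P)%Z)%R by rewrite modz_ge0 // /P; lia.
  set h := (_ %/ _)%Z; set t := (_ %% _)%Z => t0 E t6.
  rewrite (_ : (q - _)%R = (h * P + (t - e + 3 * Posz V))%R); last by lia.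
  by rewrite modzMDl modz_small; rewrite /P; lia.
have y0 : y <> zero_point.
  move=> /(congr1 (fun z : fullshift n => z (3 * Posz V)%R)).
  rewrite /y modz_small; last by rewrite /P; lia.
  by rewrite ifF ?ifT //; lia.
have fy0 : f y <> zero_point by rewrite -{1}f0 => /autinf_inj.
have fysupp q : f y q != z0 ->
    (((q - (- (2 * Posz V)) * 3)%R %% P)%Z < Posz (4 * V + 1) * 3)%R.
  move=> fyq; have [e [er ye]] : exists e : int, (- Posz r <= e <= Posz r)%R /\ y (q +
      e)%R != z0.
    apply: contrapT => /forallNP none; move/eqP: fyq; apply.
    rewrite (fr q y zero_point) ?f0 // => e er.
    apply/eqP/negPn/negP => ye; apply: (none (e - q)%R); split; first by lia.
    by rewrite addrC subrK.
  by apply: (support q e) => //; lia.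
have E : Phi f (translate (a l * 3)%R y) = translate (a l * 3)%R (f y).
  apply: (aP l _ f r _ fr fVr _ y (4 * V + 1)%N (- (2 * Posz V))%R) => //; try by lia.
  - by rewrite /l mulnCA mulnC; apply: aut_shift_mull.
  - by move=> q yq; apply: (support q 0%R); rewrite ?addr0 //; lia.
have {E} E : Phi f (translate (Posz b * 3)%R y) = translate (Posz b * 3)%R (f y).
  have acE : (a l * 3 = c * Posz (3 * m.+1) + Posz b * 3)%R by rewrite ac; lia.
  move: E; rewrite acE -!translateD aut_shift_translate;
      last exact: (endo_aut_shift PhiM Phisigma).
  by move/(can_inj (translateK _)).
have -> : Phi f (translate (Posz b * 3)%R x) i = Phi f (translate (Posz b * 3)%R y) i.
  by apply: PhiR => q qR; rewrite /translate yx //; lia.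
rewrite E /translate; apply: fr => q qr; apply: yx; lia.
Qed.

(** If f moves the zero point to z, a gate h fixing the zero point maps z to
    a point q of period 3, and a gate e with 3 cells maps q back to the zero
    point.  Then e h f and h fix the zero point, and e is fixed by Phi and
    commutes with sigma^3. *)
Lemma conjugated_all m : (0 < m)%N -> exists b : int,
  forall f, aut_shift (3 * m) f -> conjugated b f.
Proof.
move=> m0; have [b bP] := fix_zero_conjugated m0; exists b => f fm.
have cM g h : conjugated b g -> conjugated b h -> conjugated b (g * h).
  by move=> gb hb x; rewrite PhiM !autinfM hb gb.
have cV g : conjugated b g -> conjugated b (g^-1)%g.
  move=> gb x; apply: (@autinf_inj _ (Phi g)).
  by rewrite (endo_invg PhiM) autinfVK gb autinfVK.
have cG (s : {perm word n 2}) : conjugated b (gate s).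
  by move=> x; rewrite Phigate; apply/aut_shift_translate/gate_aut.
pose k := (3 * m).-1; have kE : k.+1 = (3 * m)%N by rewrite /k; lia.
have k3 : (3 %| k.+1)%N by rewrite kE dvdn_mulr.
have fk : aut_shift k.+1 f by rewrite kE.
have p0 j : periodic j zero_point by [].
set z := f zero_point; have pz : periodic k z by apply: aut_periodic.
have [zE|/eqP z_ne] := eqVneq (block k z 0) (block k zero_point 0).
  by apply: bP => //; rewrite -/z -(periodize_block pz) zE periodize_block.
pose w0 := block 2 zero_point 0.
have W7 := @card_letter _ z0 z1 z10.
have [w1] := @exists_fresh _ [:: w0] (leq_trans (isT : 1 < 8)%N W7).
rewrite inE => w10.
pose e : autinf n := gate (tperm w1 w0); pose q : fullshift n := periodize w1.
have eq : e q = zero_point.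
  rewrite /e -word_permE; last exact: gate_aut.
  by rewrite word_perm_gate tpermL periodize_block.
have pq : periodic k q.
  rewrite /periodic (_ : per k = (Posz m * per 2)%R); last by rewrite /per kE; lia.
  exact/periodicX/periodize_periodic.
have e0 : e zero_point <> zero_point.
  rewrite -{2}eq => /autinf_inj E; move: w10.
  by rewrite -(block_periodize w1 0) -/q -E eqxx.
have q0 : block k q 0 <> block k zero_point 0.
  move=> E; apply: e0; rewrite -{2}eq; congr (e _).
  by rewrite -(periodize_block pq) E periodize_block.
pose h : autinf n := gate (tperm (block k z 0) (block k q 0)).
have hE x : periodic k x -> h x =
    periodize (tperm (block k z 0) (block k q 0) (block k x 0)).
  move=> px; rewrite -{1}(periodize_block px) -word_permE; last exact: gate_aut.
  by rewrite word_perm_gate.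
have hz : h z = q by rewrite hE // tpermL periodize_block.
have h0 : h zero_point = zero_point.
  by rewrite hE // tpermD ?periodize_block //; apply/eqP => E; [apply: z_ne|apply: q0].
have hk : aut_shift (3 * m) h by rewrite -kE; apply: gate_aut.
have ek : aut_shift (3 * m) e by apply/aut_shift_mull/gate_aut.
have -> : f = h^-1 * (e^-1 * (e * h * f)) by rewrite !mulgA mulgKV mulVg mul1g.
apply: (cM _ _); first exact/cV/bP.
apply: (cM _ _); first exact/cV/cG.
apply: bP; last by rewrite !autinfM -/z hz.
by rewrite -kE; apply: aut_shiftM => //; apply: aut_shiftM; rewrite kE.
Qed.

Lemma conj_exponent k : (0 < k)%N -> exists r : nat, (r < k)%N /\
  forall f, aut_shift k f -> Phi f = f ^ (sigma n ^+ r).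
Proof.
move=> k0; have [b bP] := conjugated_all k0.
exists (absz ((- (b * 3))%R %% Posz k)%Z); split; first by lia.
move=> f fk; apply: autinf_eqP => x.
set r := absz _; have [c cE] : exists c : int, (- (b * 3) = c * Posz k + Posz r)%R.
  by exists (((- (b * 3))%R %/ Posz k)%Z);
      rewrite {1}(divz_eq (- (b * 3))%R (Posz k)) /r; lia.
rewrite conjgE !autinfM sigmaXE sigmaXVE.
have f3k : aut_shift (3 * k) f by rewrite mulnC; apply: aut_shift_mull.
rewrite -{1}(translateK (- (b * 3))%R x) opprK bP //.
rewrite cE -translateD aut_shift_translate // !translateD.
by rewrite (_ : (b * 3 + c * Posz k = - Posz r)%R) //; lia.
Qed.

(** The gate exchanging the null word with the word having a single mark at
    its first cell remembers the positions of the marks modulo k. *)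
Lemma conj_sigma_inj k r s : (0 < k)%N ->
  (forall f, aut_shift k f -> f ^ (sigma n ^+ r) = f ^ (sigma n ^+ s)) -> r = s %[mod k].
Proof.
case: k => // k _ rs.
pose w0 : word n k := [ffun=> z0]; pose w1 : word n k :=
    [ffun j => if j == ord0 then z1 else z0].
pose f : autinf n := gate (tperm w0 w1).
have f0 : f zero_point = periodize w1.
  have -> : zero_point = periodize w0 by apply: funext => i; rewrite /periodize ffunE.
  by rewrite -word_permE ?word_perm_gate ?tpermL //; apply: gate_aut.
have := congr1 (fun g : autinf n => g zero_point (Posz r)) (rs f (gate_aut _)).
have tz l : translate (Posz l) zero_point = zero_point by [].
rewrite !conjgE !autinfM !sigmaXE !sigmaXVE !tz f0 /translate /periodize !ffunE subrr.
rewrite (_ : phase k 0 = ord0); last first.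
  by apply: val_inj; apply/eqP; rewrite -eqz_nat phaseE mod0z.
rewrite eqxx; case: ifP => [/eqP E _|_ /eqP]; last by rewrite (negPf z10).
apply/eqP; rewrite -eqz_nat -!modz_nat eqz_mod_dvd; apply/dvdz_mod0P.
by have := phaseE k (Posz r - Posz s)%R; rewrite E.
Qed.

(** The exponents on the groups Aut(sigma^k) are coherent because each is
    determined modulo k by the restriction of Phi. *)
Lemma rigid_twist : exists a : zhat, forall f, Phi f = twist a f.
Proof.
have /choice[r rP] := fun m => conj_exponent (ltn0Sn m).
pose a m : 'I_m.+1 := Ordinal (rP m).1.
have ac : zhat_coherent a.
  move=> m k; apply: (@conj_sigma_inj m.+1) => // f fm.
  rewrite -(rP m).2 // -(rP _).2 // prednK ?muln_gt0 // mulnC; exact: aut_shift_mull.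
exists (Zhat ac) => f.
have [k [k0 fk]] := period_exists f; case: k k0 fk => // k _ fk.
by rewrite (twistE (k := k.+1) (r := r k)) // (rP k).2.
Qed.

End Rigid.

(** * Counting the cosets *)

Section Cosets.
Variable n : nat.
Hypothesis n2 : (1 < n)%N.
Implicit Types (x y : groupaut (autinf n)).

Definition generator (i : unit + {perm word n 2} + 'I_3) : autinf n :=
  match i with
  | inl (inl _) => sigma n
  | inl (inr s) => gate s
  | inr t => slider n t
  end.

Lemma groupautM x : {morph x : f g / f * g}.
Proof. by case: x => x xM /=; apply/asboolP. Qed.

Lemma groupaut_comp x y f : (x * y : groupaut (autinf n)) f = x (y f).
Proof. by []. Qed.

Lemma eq_generators_twistaut x y :
  (forall i, x (generator i) = y (generator i)) -> exists a, x = y * twistaut n a.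
Proof.
move=> xy; set z := y^-1 * x.
have zfix i : z (generator i) = generator i.
  rewrite groupaut_comp xy -groupaut_comp mulVg //.
have [a aP] := rigid_twist n2 (@groupautM z) (zfix (inl (inl tt)))
  (fun s => zfix (inl (inr s))) (fun t => zfix (inr t)).
exists a; rewrite -[LHS](mulKVg y) -/z; congr (_ * _).
by apply/val_inj/bijectionP => f; rewrite /= -aP.
Qed.

Lemma left_coset_twistaut y a :
  [set y * twistaut n a * h | h in range (@twistaut n)] =
      [set y * h | h in range (@twistaut n)].
Proof.
rewrite eqEsubset; split=> _ [_ [b _ <-] <-].
  by exists (twistaut n (a + b)%R); [exists (a + b)%R|rewrite twistautD mulgA].
exists (twistaut n (- a + b)%R); first by exists (- a + b)%R.
by rewrite -mulgA -twistautD addrA subrr add0r.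
Qed.

End Cosets.

Theorem theorem6p2 (n : nat) (hn : (2 <= n)%N) :
  countable (left_cosets (range (@twistaut n))).
Proof.
have [c c_inj] := autinf_code n.
pose key (x : groupaut (autinf n)) := pickle [ffun i => c (x (generator i))].
pose coset (x : groupaut (autinf n)) := [set x * h | h in range (@twistaut n)].
have key_coset x y : key x = key y -> coset x = coset y.
  move/(pcan_inj pickleK)/ffunP => xy.
  have [i|a ->] := @eq_generators_twistaut n hn x y; last exact: left_coset_twistaut.
  by apply: c_inj; have := xy i; rewrite !ffunE.
pose repr C := if pselect (exists x, coset x = C) is left e then projT1 (cid e) else 1.
have reprK C : left_cosets (range (@twistaut n)) C -> coset (repr C) = C.
  move=> [x _ xC]; rewrite /repr; case: pselect => [e|[]]; last by exists x.
  by case: (cid e).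
apply/countable_injP; exists (key \o repr) => C D /set_mem CL /set_mem DL /= E.
by rewrite -(reprK C CL) -(reprK D DL); apply: key_coset.
Qed.
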